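(* Let $I=(u_1,\ldots,u_r)$ be a monomial ideal in $R=\Bbbk[x_1,\ldots,x_n]$, with $u_1,\ldots,u_r$ monomials. Let $I_i=(u_i)$ and let $F_i$ be the Koszul resolution $0\to Rf_i\to R\to 0$, $f_i\mapsto u_i$, of $R/I_i$. Then the Taylor resolution $T_\bullet$ of $I$ (on $u_1,\ldots,u_r$) and the generalized Taylor resolution $F_1*\cdots*F_r$ are isomorphic as DG $\Gamma$-algebras.
   Context: Conventions. $\Bbbk$ is a field and $R=\Bbbk[x_1,\ldots,x_n]$ is $\mathbb{Z}^n$-graded with $\deg x_i$ the $i$-th standard basis vector. All complexes over $R$ are bigraded: $|x|$ is the homological degree of $x$, and the internal (multi)degree of $x$ is denoted by the unique monomial $m_x=\deg x$ of $R$ with the same $\mathbb{Z}^n$-degree. ''Bigraded'' (bihomogeneous) elements are homogeneous for both gradings. Brackets $[\ldots]$ denote least common multiple. A term whose scalar coefficient in $\Bbbk$ is $0$ is read as $0$. DG algebra. A DG algebra over $R$ is a complex $A$ of finitely generated free $R$-modules with differential $\partial$ and a unitary associative multiplication respecting both gradings such that, for homogeneous $a,b$: $\partial(ab)=\partial(a)b+(-1)^{|a|}a\partial(b)$; $ab=(-1)^{|a||b|}ba$; and $a^2=0$ if $|a|$ is odd. DG $\Gamma$-algebra. A DG algebra $A$ is a DG $\Gamma$-algebra if to every bihomogeneous $x\in A$ of even positive homological degree there is associated a sequence $x^{(k)}\in A$, $k=0,1,2,\ldots$, satisfying: (1) $x^{(0)}=1$, $x^{(1)}=x$, $|x^{(k)}|=k|x|$,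 $\deg x^{(k)}=(\deg x)^k$; (2) $x^{(h)}x^{(k)}=\binom{h+k}{h}x^{(h+k)}$; (3) if $x,y$ have the same bidegree, $(x+y)^{(k)}=\sum_{i+j=k}x^{(i)}y^{(j)}$; (4) for $k\ge2$ and $x,y$ bihomogeneous, $(xy)^{(k)}=0$ if $|x|$ and $|y|$ are odd, and $(xy)^{(k)}=x^ky^{(k)}$ if $|x|$ is even and $|y|$ is even and positive; (5) $(x^{(h)})^{(k)}=\frac{(hk)!}{k!(h!)^k}x^{(hk)}$; (6) $\partial(x^{(k)})=x^{(k-1)}\partial(x)$ for $k\ge1$. A map of DG $\Gamma$-algebras is a map of DG algebras commuting with divided powers. Taylor resolution. For $F\subseteq[r]=\{1,\ldots,r\}$ let $m_F$ be the least common multiple of the $u_i$, $i\in F$. $T_i$ is free with basis $\{e_F: F\subseteq[r],|F|=i\}$, $e_F$ has multidegree $m_F$, and $\partial(e_F)=\sum_{i\in F}(-1)^{\alpha(F,i)}\frac{m_F}{m_{F\setminus\{i\}}}e_{F\setminus\{i\}}$ with $\alpha(F,i)=|\{j\in F: j<i\}|$. It is a free resolution of $R/I$. Its DG algebra structure is $e_Ve_W=(-1)^{\alpha(V,W)}\frac{m_Vm_W}{m_{V\cup W}}e_{V\cup W}$ if $V\cap W=\emptyset$ and $e_Ve_W=0$ otherwise, where $\alpha(V,W)=|\{(i,j)\in V\times W: j<i\}|$. Its DG $\Gamma$-structure is the unique one with $e_F^{(k)}=0$ for $k\geq2$ (for $|F|$ even and positive); divided powers of linear combinations are computed by the axioms.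 Generalized Taylor resolution. Let $F_i$ be a multigraded free resolution of $R/I_i$ with bihomogeneous basis $a_{i,1},\ldots,a_{i,n_i}$ (here $\{1,f_i\}$, with $m_{f_i}=u_i$). For a bigraded $g_i\in F_i$ write $\partial^{F_i}(g_i)=\sum_{j=1}^{n_i}\alpha_{i,j}\frac{m_{g_i}}{m_{a_{i,j}}}a_{i,j}$ with $\alpha_{i,j}\in\Bbbk$. As an $R$-module, $F_1*\cdots*F_r=F_1\otimes_R\cdots\otimes_R F_r$, with homological degree $|g_1|+\cdots+|g_r|$, and for basis elements the simple tensor is written $g_1*\cdots*g_r$, with multidegree $[m_{g_1},\ldots,m_{g_r}]$. On basis elements the differential is $$\partial(g_1*\cdots*g_r)=\sum_{i=1}^r(-1)^{|g_1|+\cdots+|g_{i-1}|}\sum_{j=1}^{n_i}\alpha_{i,j}\frac{[m_{g_1},\ldots,m_{g_r}]}{[m_{g_1},\ldots,m_{g_{i-1}},m_{a_{i,j}},m_{g_{i+1}},\ldots,m_{g_r}]}g_1*\cdots*g_{i-1}*a_{i,j}*g_{i+1}*\cdots*g_r .$$ If $gg'=\sum_{j}\alpha_{i,j,g,g'}\frac{m_gm_{g'}}{m_{a_{i,j}}}a_{i,j}$ in $F_i$ with $\alpha_{i,j,g,g'}\in\Bbbk$, the product on basis elements is $$(g_1*\cdots*g_r)(g_1'*\cdots*g_r')=(-1)^{\sum_{i=1}^r|g_i'|\sum_{j=i+1}^r|g_j|}\sum_{j_1,\ldots,j_r}\alpha_{1,j_1,g_1,g_1'}\cdots\alpha_{r,j_r,g_r,g_r'}\frac{[m_{g_1},\ldots,m_{g_r}][m_{g_1'},\ldots,m_{g_r'}]}{[m_{a_{1,j_1}},\ldots,m_{a_{r,j_r}}]}a_{1,j_1}*\cdots*a_{r,j_r}.$$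 The DG $\Gamma$-structure on $F_1*\cdots*F_r$ is the unique one for which the inclusions $F_i\to F_1*\cdots*F_r$ (placing an element in position $i$ and $1$ elsewhere) are maps of DG $\Gamma$-algebras; explicitly, on basis elements of positive even homological degree and for $k\ge2$, $(g_1*\cdots*g_r)^{(k)}=0$ if some $|g_l|$ is odd, and $(g_1*\cdots*g_r)^{(k)}=g_1^k*\cdots*g_{j-1}^k*g_j^{(k)}*g_{j+1}^k*\cdots*g_r^k$ if all $|g_l|$ are even and $j$ is smallest with $|g_j|>0$. Each Koszul resolution $F_i$ has its usual exterior algebra structure ($f_i^2=0$) and no elements of even positive homological degree, so its divided power structure is trivial. *)

(* Defs.v *)
From HB Require Import structures.
From mathcomp Require Import all_boot all_order all_algebra.
From mathcomp.multinomials Require Export mpoly.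

Set Implicit Arguments.
Unset Strict Implicit.
Unset Printing Implicit Defensive.

Import GRing.Theory.
Local Open Scope ring_scope.

Definition mlcm (n : nat) (m1 m2 : 'X_{1..n}) : 'X_{1..n} :=
  [multinom maxn (m1 i) (m2 i) | i < n].

(* The free module on a finite set B over K[x_1, .., x_n]. The ^o makes the
   scalars act through the polynomial ring: {mpoly K[n]} by itself is a module
   over K. *)
Notation freemod K n B := {ffun B -> {mpoly K[n]}^o}.

Definition ebasis (K : fieldType) (n : nat) (B : finType) (b : B) :
  freemod K n B := [ffun a => (a == b)%:R].

(* Bigraded free modules with a finite homogeneous basis, carrying the raw
   operations of a DG Gamma-algebra; multidegrees are monomials. Divided powers
   are total functions whose values are meaningful only on bihomogeneous
   elements of even positive homological degree. *)
Record dgg_data (K : fieldType) (n : nat) := DGGData {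
  basis : finType;
  hdeg : basis -> nat;
  mdegb : basis -> 'X_{1..n};
  dg_one : freemod K n basis;
  dg_diff : freemod K n basis -> freemod K n basis;
  dg_mul : freemod K n basis -> freemod K n basis -> freemod K n basis;
  dg_dpow : freemod K n basis -> nat -> freemod K n basis
}.

Arguments dg_one {K n} A : rename.
Arguments dg_diff {K n A} x : rename.
Arguments dg_mul {K n A} x y : rename.
Arguments dg_dpow {K n A} x k : rename.

Definition dg_carrier (K : fieldType) (n : nat) (A : dgg_data K n) :
  lmodType {mpoly K[n]} := freemod K n (basis A).
Coercion dg_carrier : dgg_data >-> GRing.Lmodule.type.

Definition dg_exp (K : fieldType) (n : nat) (A : dgg_data K n) (x : A) (k : nat)
  : A := iter k (@dg_mul K n A x) (dg_one A).

Definition homogeneous (K : fieldType) (n : nat) (A : dgg_data K n) (i : nat) (x : A)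
  : Prop :=
  forall b : basis A, (x : freemod K n (basis A)) b != 0 -> hdeg b = i.

Definition bihomogeneous (K : fieldType) (n : nat) (A : dgg_data K n)
  (i : nat) (m : 'X_{1..n}) (x : A) : Prop :=
  forall b : basis A, (x : freemod K n (basis A)) b != 0 ->
  [/\ hdeg b = i, (mdegb b <= m)%MM &
      exists c : K,
        (x : freemod K n (basis A)) b = c%:MP * 'X_[(m - mdegb b)%MM]].

Record is_dg_algebra (K : fieldType) (n : nat) (A : dgg_data K n) : Prop := {
  dg_diff_linear : linear (dg_diff : A -> A);
  dg_diff_bihomog : forall i m (x : A),
    bihomogeneous i.+1 m x -> bihomogeneous i m (dg_diff x : A);
  dg_diff_bihomog0 : forall m (x : A), bihomogeneous 0 m x -> dg_diff x = 0;
  dg_diff_diff : forall x : A, dg_diff (dg_diff x) = 0;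
  dg_mul_linearr : forall x : A, linear (dg_mul x : A -> A);
  dg_mul_linearl : forall y : A, linear ((fun x => dg_mul x y) : A -> A);
  dg_mulA : associative (@dg_mul K n A);
  dg_mul1 : left_id (dg_one A) (@dg_mul K n A);
  dg_mulr1 : right_id (dg_one A) (@dg_mul K n A);
  dg_one_bihomog : bihomogeneous 0 0%MM (dg_one A : A);
  dg_mul_bihomog : forall i j m p (x y : A),
    bihomogeneous i m x -> bihomogeneous j p y -> bihomogeneous (i + j) (m + p)%MM (dg_mul x y : A);
  dg_leibniz : forall i j (a b : A), homogeneous i a -> homogeneous j b ->
    dg_diff (dg_mul a b) =
      dg_mul (dg_diff a) b + (-1) ^+ i *: dg_mul a (dg_diff b);
  dg_mulC : forall i j (a b : A), homogeneous i a -> homogeneous j b ->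
    dg_mul a b = (-1) ^+ (i * j) *: dg_mul b a;
  dg_sqr_odd : forall i (a : A), odd i -> homogeneous i a -> dg_mul a a = 0
}.

(* Bidegrees admitting divided powers: homological degree even and positive. *)
Definition even_pos (i : nat) : bool := (0 < i)%N && ~~ odd i.

Record is_dgg_algebra (K : fieldType) (n : nat) (A : dgg_data K n) : Prop := {
  dgg_dg :> is_dg_algebra A;
  dgg_dpow0 : forall i m (x : A), even_pos i -> bihomogeneous i m x ->
    dg_dpow x 0 = dg_one A;
  dgg_dpow1 : forall i m (x : A), even_pos i -> bihomogeneous i m x ->
    dg_dpow x 1 = x;
  dgg_dpow_bihomog : forall i m (x : A) k, even_pos i -> bihomogeneous i m x ->
    bihomogeneous (k * i) (m *+ k)%MM (dg_dpow x k : A);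
  dgg_dpow_mul : forall i m (x : A) h k, even_pos i -> bihomogeneous i m x ->
    dg_mul (dg_dpow x h) (dg_dpow x k) = dg_dpow x (h + k) *+ 'C(h + k, h);
  dgg_dpow_add : forall i m (x y : A) k, even_pos i ->
    bihomogeneous i m x -> bihomogeneous i m y ->
    dg_dpow (x + y) k = \sum_(j < k.+1) dg_mul (dg_dpow x j) (dg_dpow y (k - j));
  dgg_dpow_mul_odd : forall i j m p (x y : A) k, odd i -> odd j ->
    bihomogeneous i m x -> bihomogeneous j p y -> (2 <= k)%N -> dg_dpow (dg_mul x y) k = 0;
  dgg_dpow_mul_even : forall i j m p (x y : A) k, ~~ odd i -> even_pos j ->
    bihomogeneous i m x -> bihomogeneous j p y -> (2 <= k)%N ->
    dg_dpow (dg_mul x y) k = dg_mul (dg_exp x k) (dg_dpow y k);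
  (* h = 0 is left out: x^(0) = 1 has homological degree 0. *)
  dgg_dpow_dpow : forall i m (x : A) h k, even_pos i -> bihomogeneous i m x ->
    (0 < h)%N ->
    dg_dpow (dg_dpow x h) k =
      dg_dpow x (h * k) *+ ((h * k)`! %/ (k`! * h`! ^ k));
  dgg_diff_dpow : forall i m (x : A) k, even_pos i -> bihomogeneous i m x ->
    (0 < k)%N ->
    dg_diff (dg_dpow x k) = dg_mul (dg_dpow x k.-1) (dg_diff x)
}.

Record is_dgg_map (K : fieldType) (n : nat) (A B : dgg_data K n) (f : A -> B)
  : Prop := {
  dgg_map_linear : linear f;
  dgg_map_bihomog : forall i m x, bihomogeneous i m x -> bihomogeneous i m (f x);
  dgg_map_diff : forall x, f (dg_diff x) = dg_diff (f x);
  dgg_map_one : f (dg_one A) = dg_one B;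
  dgg_map_mul : forall x y, f (dg_mul x y) = dg_mul (f x) (f y);
  dgg_map_dpow : forall i m x k, even_pos i -> bihomogeneous i m x ->
    f (dg_dpow x k) = dg_dpow (f x) k
}.

Definition dgg_isomorphic (K : fieldType) (n : nat) (A B : dgg_data K n) : Prop :=
  exists (f : A -> B) (g : B -> A),
    [/\ is_dgg_map f, is_dgg_map g, cancel f g & cancel g f].

(* Structure constants in K on a homogeneous basis; the monomial coefficients
   are forced by the multidegrees:
     d g     = \sum_a  sc_diff g a   * m_g / m_a         * a
     g g'    = \sum_a  sc_mul g g' a * m_g m_g' / m_a    * a
     g^(k)   = \sum_a  sc_dpow g k a * m_g ^ k / m_a     * a     (k >= 2),
   the last one being used for g of even positive degree only. *)
Record struct_consts (K : fieldType) (n : nat) := StructConsts {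
  sc_basis : finType;
  sc_hdeg : sc_basis -> nat;
  sc_mdeg : sc_basis -> 'X_{1..n};
  sc_unit : sc_basis;
  sc_diff : sc_basis -> sc_basis -> K;
  sc_mul : sc_basis -> sc_basis -> sc_basis -> K;
  sc_dpow : sc_basis -> nat -> sc_basis -> K
}.

Section OfStructConsts.
Variables (K : fieldType) (n : nat) (S : struct_consts K n).
Local Notation B := (sc_basis S).
Local Notation M := (freemod K n B).
Local Notation m_ := (@sc_mdeg K n S).

Definition sc_one : M := ebasis K n (sc_unit S).

Definition ext_diff (x : M) : M :=
  [ffun a => \sum_g x g * ((sc_diff g a)%:MP * 'X_[(m_ g - m_ a)%MM])].

Definition ext_mul (x y : M) : M :=
  [ffun a => \sum_g \sum_h
     x g * y h * ((sc_mul g h a)%:MP * 'X_[(m_ g + m_ h - m_ a)%MM])].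

Definition basis_dpow (g : B) (k : nat) : M :=
  if k is 0 then sc_one
  else if k is 1 then ebasis K n g
  else [ffun a => (sc_dpow g k a)%:MP * 'X_[(m_ g *+ k - m_ a)%MM]].

(* The value forced by the axioms: for x = \sum_b x_b b,
   x^(k) = \sum_(k_b, \sum k_b = k) \prod_b x_b ^ k_b b^(k_b). *)
Definition ext_dpow (x : M) (k : nat) : M :=
  \sum_(kk : {ffun B -> 'I_k.+1} | (\sum_b (kk b : nat))%N == k)
    \big[ext_mul/sc_one]_(b : B) ((x b ^+ kk b) *: basis_dpow b (kk b)).

Definition dgg_of : dgg_data K n :=
  DGGData (@sc_hdeg K n S) m_ sc_one ext_diff ext_mul ext_dpow.

(* Structure constants of powers: g ^ k = \sum_a sc_exp g k a m_g ^ k / m_a a. *)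
Fixpoint sc_exp (g : B) (k : nat) (a : B) : K :=
  if k is k'.+1 then \sum_(b : B) sc_exp g k' b * sc_mul g b a
  else (a == sc_unit S)%:R.

End OfStructConsts.

Section Taylor.
Variables (K : fieldType) (n r : nat) (u : 'I_r -> 'X_{1..n}).
Implicit Types F V W U : {set 'I_r}.

Definition mlcm_set F : 'X_{1..n} := \big[@mlcm n/0%MM]_(i in F) u i.

Definition alpha1 F (i : 'I_r) : nat := #|[set j in F | (j < i)%N]|.

Definition alpha2 V W : nat :=
  #|[set p : 'I_r * 'I_r | [&& p.1 \in V, p.2 \in W & (p.2 < p.1)%N]]|.

Definition taylor_consts : struct_consts K n := {|
  sc_basis := {set 'I_r};
  sc_hdeg := fun F => #|F|;
  sc_mdeg := mlcm_set;
  sc_unit := set0;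
  sc_diff := fun F G =>
    \sum_(i in F) (-1) ^+ alpha1 F i * (G == F :\ i)%:R;
  sc_mul := fun V W U =>
    if [disjoint V & W] && (U == V :|: W) then (-1) ^+ alpha2 V W else 0;
  sc_dpow := fun _ _ _ => 0
|}.

Definition taylor : dgg_data K n := dgg_of taylor_consts.

End Taylor.

(* 0 -> R f -> R -> 0, f |-> u, with basis {1, f} encoded as {false, true}. *)
Definition koszul_consts (K : fieldType) (n : nat) (u : 'X_{1..n}) :
  struct_consts K n := {|
  sc_basis := bool;
  sc_hdeg := fun b => nat_of_bool b;
  sc_mdeg := fun b => if b then u else 0%MM;
  sc_unit := false;
  sc_diff := fun b a => (b && ~~ a)%:R;
  sc_mul := fun b b' a => (~~ (b && b') && (a == b || b'))%:R;
  sc_dpow := fun _ _ _ => 0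
|}.

Section GenTaylor.
Variables (K : fieldType) (n r : nat) (F : 'I_r -> struct_consts K n).

Definition gt_basis : finType := {dffun forall i : 'I_r, sc_basis (F i)}.
Implicit Types g h a : gt_basis.

Definition gt_hdeg g : nat := (\sum_i sc_hdeg (g i))%N.

Definition gt_mdeg g : 'X_{1..n} := \big[@mlcm n/0%MM]_i sc_mdeg (g i).

Definition gt_unit : gt_basis := [ffun i => sc_unit (F i)].

Definition gt_diff g a : K :=
  \sum_i (if [forall l, (l != i) ==> (a l == g l)]
          then (-1) ^+ (\sum_(l < r | (l < i)%N) sc_hdeg (g l))%N
               * sc_diff (g i) (a i)
          else 0).

Definition gt_mul g h a : K :=
  (-1) ^+ (\sum_i sc_hdeg (h i) * \sum_(j < r | (i < j)%N) sc_hdeg (g j))%N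
  * \prod_i sc_mul (g i) (h i) (a i).

(* g_1^k * .. * g_(j-1)^k * g_j^(k) * g_(j+1)^k * .. * g_r^k with j smallest
   such that |g_j| > 0, and 0 if some |g_l| is odd. *)
Definition gt_dpow g k a : K :=
  if [exists l, odd (sc_hdeg (g l))] then 0
  else if [pick j | (0 < sc_hdeg (g j))%N
                    && [forall l : 'I_r, (l < j)%N ==> (sc_hdeg (g l) == 0%N)]]
       is Some j
  then \prod_i (if i == j then sc_dpow (g i) k (a i) else sc_exp (g i) k (a i))
  else 0.

Definition gen_taylor_consts : struct_consts K n :=
  @StructConsts K n gt_basis gt_hdeg gt_mdeg gt_unit gt_diff gt_mul gt_dpow.

Definition gen_taylor : dgg_data K n := dgg_of gen_taylor_consts.

End GenTaylor.

(* Main.v *)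
From HB Require Import structures.
Require Import Defs.
From mathcomp Require Import all_boot all_order all_algebra ring.

Set Implicit Arguments.
Unset Strict Implicit.
Unset Printing Implicit Defensive.

Import GRing.Theory.
Local Open Scope ring_scope.

                          

(** A basis tensor of the Koszul resolutions is determined by the set of positions that hold [f_i],
    so both algebras have a basis indexed by the subsets of ['I_r]. Under this bijection the
    degrees, multidegrees and structure constants agree ([gen_taylor_taylor_like]): the Koszul signs
    of the tensor product count the same inversions as the Taylor signs. The isomorphism is
    therefore a relabelling of the basis ([taylor_like_iso]).

    The DG Gamma axioms are checked once for both algebras ([taylor_like_dgg]). The map [embed]
    sends e_F to m_F times the exterior monomial [eps F] over the polynomial ring. All quotients of
    least common multiples then cancel: the product becomes the exterior product ([embed_mul]), the
    differential becomes contraction with the functional taking every generator to 1 ([embed_diff]),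
    and multidegree m means that every coefficient is a scalar multiple of X^m
    ([embed_bihomogeneous]). Monomials are not zero divisors, so [embed] is injective and identities
    can be verified in the exterior algebra.

    There the divided powers of x are the coefficients of the product over F of 1 + x_F eps_F X.
    Adding a term z multiplies this series by 1 + z X, whence (x + z)^(k+1) = x^(k+1) + x^(k) z
    ([dpow_addeps]). The axioms follow by induction on the terms of x, with no division by
    factorials and hence in every characteristic. *)

(** * Counting inversions between subsets *)

Section Inversions.
Variable r : nat.
Implicit Types (i j : 'I_r) (F G V W U : {set 'I_r}).

Lemma alpha2E V W :
  alpha2 V W = (\sum_(i in V) \sum_(j in W) (j < i)%N)%N.
Proof.
rewrite /alpha2 -sum1_card pair_big /= big_mkcond [RHS]big_mkcond.
apply: eq_bigr => -[i j] _ /=; rewrite inE /=.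
by case: (i \in V); case: (j \in W); case: (j < i)%N.
Qed.

Lemma alpha1E F i : alpha1 F i = alpha2 [set i] F.
Proof.
rewrite alpha2E big_set1 /alpha1 -sum1_card big_mkcond [RHS]big_mkcond.
by apply: eq_bigr => j _; rewrite inE; case: (j \in F); case: (j < i)%N.
Qed.

Lemma alpha2Ul V V' W :
  [disjoint V & V'] -> alpha2 (V :|: V') W = (alpha2 V W + alpha2 V' W)%N.
Proof.
move=> dV; rewrite !alpha2E (eq_bigl [predU V & V']) ?bigU //.
by move=> i; rewrite !inE.
Qed.

Lemma alpha2Ur V W W' :
  [disjoint W & W'] -> alpha2 V (W :|: W') = (alpha2 V W + alpha2 V W')%N.
Proof.
move=> dW; rewrite !alpha2E -big_split; apply: eq_bigr => i _ /=.
rewrite (eq_bigl [predU W & W']) ?bigU //.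
by move=> j; rewrite !inE.
Qed.

Lemma alpha2_0l W : alpha2 set0 W = 0%N.
Proof. by rewrite alpha2E big_set0. Qed.

Lemma alpha2_0r V : alpha2 V set0 = 0%N.
Proof. by rewrite alpha2E big1 // => i _; rewrite big_set0. Qed.

(** Each pair of V x W is inverted in exactly one of the two orders, since disjointness excludes
    equal entries. This is the source of the sign in graded commutativity. *)
Lemma alpha2_sym V W :
  [disjoint V & W] -> (alpha2 V W + alpha2 W V = #|V| * #|W|)%N.
Proof.
move=> dVW; rewrite !alpha2E [X in (_ + X)%N]exchange_big -big_split /=.
rewrite -sum_nat_const; apply: eq_bigr => i iV.
rewrite -big_split /= -sum1_card; apply: eq_bigr => j jW.
have : (i : nat) != j.
  by apply: contraTneq jW => /ord_inj <-; rewrite (disjointFr dVW iV).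
by case: ltngtP.
Qed.

Lemma alpha1D1 F i : alpha1 (F :\ i) i = alpha1 F i.
Proof.
by apply: eq_card => j; rewrite !inE; case: eqP => //= ->; rewrite ltnn andbF.
Qed.

End Inversions.

                                             

(** * The exterior algebra on [r] generators and its contraction differential *)

Section ExteriorAlgebra.
Variables (R : comNzRingType) (r : nat).
Implicit Types (i j : 'I_r) (F G V W U : {set 'I_r}).

(** Coefficient families of exterior algebra elements. The separate name lets the exterior product
    become the ring multiplication of this type. *)
Definition extalg := {ffun {set 'I_r} -> R^o}.
HB.instance Definition _ := GRing.Lmodule.on extalg.
Implicit Types x y z : extalg.

Definition eps F : extalg := [ffun G => (G == F)%:R].

Lemma extalgE x : x = \sum_F x F *: eps F.
Proof.
apply/ffunP => G; rewrite sum_ffunE (bigD1 G) //= big1 ?addr0.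
  by rewrite !ffunE eqxx /GRing.scale /= mulr1.
by move=> F FG; rewrite !ffunE eq_sym (negPf FG) scaler0.
Qed.

Lemma addeE x y F : (x + y) F = x F + y F. Proof. exact: ffunE. Qed.

Lemma sumeE (I : Type) (s : seq I) (Q : pred I) (f : I -> extalg) F :
  (\sum_(k <- s | Q k) f k) F = \sum_(k <- s | Q k) f k F.
Proof. exact: sum_ffunE. Qed.

Lemma scaleeE (c : R) x F : (c *: x) F = c * x F. Proof. exact: ffunE. Qed.

Lemma epsE F G : eps F G = (G == F)%:R. Proof. exact: ffunE. Qed.

Lemma sum_epsE (I : finType) (f : I -> {set 'I_r}) (c : I -> R) k :
  injective f -> (\sum_l c l *: eps (f l)) (f k) = c k.
Proof.
move=> f_inj; rewrite sumeE (bigD1 k) //= scaleeE epsE eqxx mulr1.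
rewrite big1 ?addr0 // => l lk.
by rewrite scaleeE epsE (inj_eq f_inj) eq_sym (negPf lk) mulr0.
Qed.

Definition supp_in (P : pred {set 'I_r}) x := forall F, x F != 0 -> P F.

Lemma supp_in0 P : supp_in P 0.
Proof. by move=> F; rewrite ffunE eqxx. Qed.

Lemma supp_inD P x y : supp_in P x -> supp_in P y -> supp_in P (x + y).
Proof.
move=> Px Py F; rewrite addeE => /eqP nz.
have [x0|/Px//] := eqVneq (x F) 0; apply: Py; apply/eqP => y0.
by case: nz; rewrite x0 y0 addr0.
Qed.

Lemma supp_inZ P (c : R) x : supp_in P x -> supp_in P (c *: x).
Proof.
by move=> Px F; rewrite scaleeE => h; apply: Px; apply: contraNneq h => ->;
  rewrite mulr0.
Qed.

Lemma supp_in_eps (P : pred {set 'I_r}) F : P F -> supp_in P (eps F).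
Proof. by move=> PF G; rewrite epsE; case: (eqVneq G F) => [->|]; rewrite ?eqxx. Qed.

Lemma supp_in_sum P (I : Type) (s : seq I) (Q : pred I) (f : I -> extalg) :
  (forall k, Q k -> supp_in P (f k)) -> supp_in P (\sum_(k <- s | Q k) f k).
Proof.
by move=> h; apply: big_ind => //; [exact: supp_in0 | exact: supp_inD].
Qed.

(** Induction on the number of terms that stays inside a graded piece. Most identities below reduce
    in this way to monomials [eps F]. *)
Lemma extalg_ind (P : pred {set 'I_r}) (Q : extalg -> Prop) :
  Q 0 ->
  (forall (c : R) F x, P F -> supp_in P x -> Q x -> Q (x + c *: eps F)) ->
  forall x, supp_in P x -> Q x.
Proof.
move=> Q0 QD x Px; rewrite (extalgE x).
(* The support bound is carried along with [Q], because the induction step needs it for the partial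
   sum. *)
have: supp_in P (\sum_F x F *: eps F) /\ Q (\sum_F x F *: eps F).
  elim/big_rec: _ => [|F y _ [Py Qy]]; first by split; [exact: supp_in0|].
  have [->|/Px PF] := eqVneq (x F) 0; first by rewrite scale0r add0r.
  rewrite addrC; split; last exact: QD.
  by apply: supp_inD => //; apply: supp_inZ; apply: supp_in_eps.
by case.
Qed.

Lemma extalg_full_ind (Q : extalg -> Prop) :
  Q 0 -> (forall (c : R) F x, Q x -> Q (x + c *: eps F)) -> forall x, Q x.
Proof.
by move=> Q0 QD x; apply: (@extalg_ind predT) => // c F y _ _; apply: QD.
Qed.

Definition esign V W : R := if [disjoint V & W] then (-1) ^+ alpha2 V W else 0.

Definition extmul x y : extalg :=
  \sum_V \sum_W (x V * y W * esign V W) *: eps (V :|: W).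

Lemma extmul_linearr x : linear (extmul x).
Proof.
move=> c y z; rewrite /extmul scaler_sumr -big_split; apply: eq_bigr => V _.
rewrite scaler_sumr -big_split; apply: eq_bigr => W _ /=.
rewrite scalerA -scalerDl addeE scaleeE; congr (_ *: _).
by rewrite mulrDr mulrDl !mulrA [x V * c]mulrC.
Qed.

Lemma extmul_linearl y : linear (extmul^~ y).
Proof.
move=> c x z; rewrite /extmul scaler_sumr -big_split; apply: eq_bigr => V _.
rewrite scaler_sumr -big_split; apply: eq_bigr => W _ /=.
rewrite scalerA -scalerDl addeE scaleeE; congr (_ *: _).
by rewrite !mulrDl !mulrA.
Qed.

HB.instance Definition _ x :=
  GRing.isLinear.Build R extalg extalg _ (extmul x) (extmul_linearr x).

Lemma extmulDl : left_distributive extmul +%R.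
Proof. by move=> x z y; have := extmul_linearl y 1 x z; rewrite !scale1r. Qed.
Lemma extmul0l y : extmul 0 y = 0.
Proof. by apply: (addrI (extmul 0 y)); rewrite -extmulDl !addr0. Qed.

Lemma extmulZl (c : R) x y : extmul (c *: x) y = c *: extmul x y.
Proof. by have := extmul_linearl y c x 0; rewrite /= extmul0l !addr0. Qed.

Lemma extmul_eps V W : extmul (eps V) (eps W) = esign V W *: eps (V :|: W).
Proof.
rewrite /extmul (bigD1 V) //= (bigD1 W) //= !epsE !eqxx !mul1r.
rewrite !big1 ?addr0 // => [V' nV|W' nW]; last first.
  by rewrite epsE (negPf nW) mulr0 mul0r scale0r.
by apply: big1 => W' _; rewrite epsE (negPf nV) !mul0r scale0r.
Qed.

(** The cocycle identity behind associativity: both sides vanish unless the three sets are pairwise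
    disjoint, and then additivity of inversion counts gives the same exponent. *)
Lemma esignA V W U :
  esign V W * esign (V :|: W) U = esign W U * esign V (W :|: U).
Proof.
rewrite /esign -!setI_eq0 setIUl setIUr !setU_eq0 !setI_eq0.
case: (boolP [disjoint V & W]) => dVW; case: (boolP [disjoint W & U]) => dWU;
  rewrite ?andbF ?mul0r ?mulr0 //= andbT.
case: ifP => dVU; rewrite ?mulr0 // -!exprD.
by rewrite alpha2Ul // alpha2Ur // addnA addnC addnA.
Qed.

Lemma extmulA : associative extmul.
Proof.
move=> x y z; elim/extalg_full_ind: x => [|c V x IHx].
  by rewrite !extmul0l.
rewrite !extmulDl !extmulZl IHx; congr (_ + _ *: _) => {x IHx}.
elim/extalg_full_ind: y => [|c' W y IHy].
  by rewrite extmul0l linear0 extmul0l.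
rewrite !(linearD, linearZ) /= !(extmulDl, extmulZl) !(linearD, linearZ) /= IHy.
congr (_ + _ *: _) => {y IHy}.
elim/extalg_full_ind: z => [|c'' U z IHz].
  by rewrite !linear0.
rewrite !(linearD, linearZ) /= IHz; congr (_ + _ *: _).
by rewrite !extmul_eps linearZ /= extmulZl !extmul_eps !scalerA esignA setUA.
Qed.

Lemma esign0l W : esign set0 W = 1.
Proof. by rewrite /esign -setI_eq0 set0I eqxx alpha2_0l. Qed.

Lemma esign0r V : esign V set0 = 1.
Proof. by rewrite /esign -setI_eq0 setI0 eqxx alpha2_0r. Qed.

Lemma extmul1l : left_id (eps set0) extmul.
Proof.
move=> x; elim/extalg_full_ind: x => [|c V x IHx].
  exact: linear0.
rewrite linearD linearZ /= IHx; congr (_ + _ *: _).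
by rewrite extmul_eps esign0l set0U scale1r.
Qed.

Lemma extmul1r : right_id (eps set0) extmul.
Proof.
move=> x; elim/extalg_full_ind: x => [|c V x IHx].
  exact: extmul0l.
rewrite extmulDl extmulZl /= IHx; congr (_ + _ *: _).
by rewrite extmul_eps esign0r setU0 scale1r.
Qed.

Lemma eps_neq0 F : eps F != 0.
Proof.
by apply/eqP => /ffunP/(_ F)/eqP; rewrite epsE ffunE eqxx oner_eq0.
Qed.

HB.instance Definition _ := GRing.Zmodule_isNzRing.Build extalg
  extmulA extmul1l extmul1r extmulDl (fun x => raddfD (extmul x))
  (eps_neq0 set0).

Let extmulE x y : x * y = extmul x y. Proof. by []. Qed.

HB.instance Definition _ :=
  GRing.Lmodule_isLalgebra.Build R extalg (fun c x y => esym (extmulZl c x y)).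

Lemma extalg_scalerAr (c : R) x y : c *: (x * y) = x * (c *: y).
Proof. by rewrite !extmulE linearZ. Qed.

HB.instance Definition _ :=
  GRing.Lalgebra_isAlgebra.Build R extalg extalg_scalerAr.

Lemma mul_eps V W : eps V * eps W = esign V W *: eps (V :|: W).
Proof. exact: extmul_eps. Qed.

Lemma eps0 : eps set0 = 1. Proof. by []. Qed.

Lemma extmul_suppE x y :
  x * y = \sum_V \sum_W (x V * y W * esign V W) *: eps (V :|: W).
Proof. by []. Qed.

Lemma supp_inM (P Q S : pred {set 'I_r}) x y :
  (forall V W, P V -> Q W -> [disjoint V & W] -> S (V :|: W)) ->
  supp_in P x -> supp_in Q y -> supp_in S (x * y).
Proof.
move=> PQS Px Qy; rewrite extmul_suppE.
apply: supp_in_sum => V _; apply: supp_in_sum => W _.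
have [->|/Px PV] := eqVneq (x V) 0; first by rewrite !mul0r scale0r; apply: supp_in0.
have [->|/Qy QW] := eqVneq (y W) 0.
  by rewrite mulr0 mul0r scale0r; apply: supp_in0.
rewrite /esign; case: ifP => [dVW|_]; last by rewrite mulr0 scale0r; apply: supp_in0.
by apply: supp_inZ; apply: supp_in_eps; apply: PQS.
Qed.

Lemma mul_eps_sym V W : eps V * eps W = (-1) ^+ (#|V| * #|W|) *: (eps W * eps V).
Proof.
rewrite !mul_eps scalerA setUC /esign [X in _ = (_ * if X then _ else _) *: _]disjoint_sym.
case: ifP => [dVW|_]; last by rewrite mulr0.
by rewrite -alpha2_sym // addnC exprD mulrAC -expr2 sqrr_sign mul1r.
Qed.

Lemma mul_eps_eps F : F != set0 -> eps F * eps F = 0.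
Proof. by move=> F0; rewrite mul_eps /esign -setI_eq0 setIid (negPf F0) scale0r. Qed.

Definition ehomog (d : nat) : extalg -> Prop := supp_in (fun F => #|F| == d).

Lemma ehomogM d e x y : ehomog d x -> ehomog e y -> ehomog (d + e) (x * y).
Proof.
apply: supp_inM => V W /eqP<- /eqP<- dVW.
by rewrite cardsU (disjoint_setI0 dVW) cards0 subn0.
Qed.

Lemma ehomog_mulC d e x y :
  ehomog d x -> ehomog e y -> x * y = (-1) ^+ (d * e) *: (y * x).
Proof.
move=> hx hy; move: x hx; apply: extalg_ind => [|c V x /eqP dV _ IHx].
  by rewrite mul0r mulr0 scaler0.
rewrite mulrDl mulrDr scalerDr IHx; congr (_ + _) => {x IHx}.
move: y hy; apply: extalg_ind => [|c' W y /eqP eW _ IHy].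
  by rewrite mul0r mulr0 scaler0.
rewrite mulrDl mulrDr scalerDr IHy; congr (_ + _) => {y IHy}.
rewrite -!scalerAl -!scalerAr mul_eps_sym dV eW !scalerA.
by congr (_ *: _); rewrite mulrC -mulrA [c' * c]mulrC.
Qed.

(** Graded commutativity alone only gives 2 x^2 = 0, which says nothing in characteristic 2. Instead
    the square is expanded: cross terms cancel in pairs and each monomial squares to zero. *)
Lemma ehomog_sqr_odd d x : odd d -> ehomog d x -> x * x = 0.
Proof.
move=> od; move: x; apply: extalg_ind => [|c F x /eqP dF hx IHx].
  by rewrite mul0r.
have hF : ehomog d (c *: eps F).
  by apply: supp_inZ; apply: supp_in_eps; apply/eqP.
rewrite mulrDl !mulrDr IHx add0r (ehomog_mulC hF hx) -signr_odd oddM od.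
rewrite expr1 scaleN1r addrA subrr add0r -scalerAl -scalerAr mul_eps_eps ?scaler0 //.
by rewrite -card_gt0 dF odd_gt0.
Qed.

Definition even_supp : extalg -> Prop := supp_in (fun F => ~~ odd #|F|).

(** Even elements are central, which is what allows factors to be reordered in the divided power
    computations. *)
Lemma even_comm x y : even_supp x -> GRing.comm x y.
Proof.
move: x; apply: extalg_ind => [|c V x ev _ IHx]; first exact/commr_sym/commr0.
apply/commr_sym/commrD; apply/commr_sym => // {x IHx}.
rewrite /GRing.comm -scalerAl -scalerAr; congr (_ *: _).
elim/extalg_full_ind: y => [|c' W y IHy].
  by rewrite mulr0 mul0r.
rewrite mulrDl mulrDr IHy; congr (_ + _).
by rewrite -scalerAl -scalerAr mul_eps_sym -signr_odd oddM (negPf ev) scale1r.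
Qed.

(** The Koszul differential of the sequence (1, ..., 1): the Taylor differential with its monomial
    coefficients removed. *)
Definition extdiff x : extalg :=
  \sum_F x F *: \sum_(i in F) (-1) ^+ alpha1 F i *: eps (F :\ i).

Lemma extdiff_linear : linear extdiff.
Proof.
move=> c x y; rewrite /extdiff scaler_sumr -big_split; apply: eq_bigr => V _ /=.
by rewrite scalerA -scalerDl addeE scaleeE.
Qed.

HB.instance Definition _ :=
  GRing.isLinear.Build R extalg extalg _ extdiff extdiff_linear.

Lemma extdiff_eps F :
  extdiff (eps F) = \sum_(i in F) (-1) ^+ alpha1 F i *: eps (F :\ i).
Proof.
rewrite /extdiff (bigD1 F) //= epsE eqxx scale1r [X in _ + X]big1 ?addr0 // => G nG.
by rewrite epsE (negPf nG) scale0r.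
Qed.

Lemma eps_setD1 F i : i \in F ->
  eps F = (-1) ^+ alpha1 F i *: (eps [set i] * eps (F :\ i)).
Proof.
move=> iF; rewrite mul_eps scalerA setD1K // /esign.
by rewrite disjoints1 !inE eqxx -alpha1E alpha1D1 -expr2 sqrr_sign scale1r.
Qed.

                                                                   
(** The Leibniz rule for a single generator. By peeling generators off a monomial, it yields both
    the general rule and the vanishing of the squared differential. *)
Lemma extdiff_gen_mul i x :
  extdiff (eps [set i] * x) = x - eps [set i] * extdiff x.
Proof.
elim/extalg_full_ind: x => [|c W x IHx].
  by rewrite mulr0 !linear0 mulr0 subr0.
rewrite mulrDr !linearD mulrDr /= IHx opprD addrACA; congr (_ + _) => {x IHx}.
rewrite !linearZ /= -!scalerAr linearZ -scalerBr; congr (_ *: _).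
have [iW|niW] := boolP (i \in W).
  (* When i lies in W the left side is zero. On the right, multiplying the differential by the
     generator i kills every term except the one that removed i, and that term gives back
     [eps W]. *)
  rewrite {1}(eps_setD1 iW) -scalerAr mulrA mul_eps_eps; last first.
    by rewrite -card_gt0 cards1.
  rewrite mul0r scaler0 linear0 extdiff_eps (bigD1 i) //= mulrDr -scalerAr.
  rewrite -eps_setD1 // mulr_sumr big1 ?addr0 ?subrr // => j /andP[jW ji].
  rewrite -scalerAr mul_eps /esign disjoints1 !inE eq_sym ji iW.
  by rewrite scale0r scaler0.
(* When i is outside W, removing i returns [eps W]; the terms removing some j in W must match those
   of the subtracted product, up to one sign. *)
rewrite mul_eps /esign disjoints1 niW linearZ /= !extdiff_eps -alpha1E.
rewrite (bigD1 i) /=; last by rewrite !inE eqxx.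
rewrite scalerDr scalerA -(alpha1D1 (i |: W)) setU1K // -expr2 sqrr_sign scale1r.
congr (_ + _); rewrite scaler_sumr mulr_sumr -sumrN.
apply: eq_big => [j|j /andP[]].
  by rewrite !inE; case: eqP => [->|]; rewrite ?andbF ?andbT // (negPf niW).
rewrite !inE => /orP[/eqP->|jW ji]; first by rewrite eqxx.
have dij : [disjoint [set i] & [set j]] by rewrite disjoints1 inE eq_sym.
rewrite -scalerAr mul_eps /esign disjoints1 !inE (negPf niW) andbF -alpha1E.
have -> : (i |: W) :\ j = i |: (W :\ j).
  by apply/setP => k; rewrite !inE; case: eqP => [->|]; rewrite ?(negPf ji) ?orbF.
rewrite !scalerA -scaleNr; congr (_ *: _).
rewrite [alpha1 (i |: W) j]alpha1E alpha2Ur ?disjoints1 // -alpha1E.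
have -> : alpha1 W i = (alpha2 [set i] [set j] + alpha1 (W :\ j) i)%N.
  by rewrite !alpha1E -alpha2Ur ?setD1K // disjoints1 !inE eqxx.
(* Exactly one of i and j precedes the other, so the two sign exponents differ by one modulo 2. *)
have := alpha2_sym dij; rewrite !cards1 mul1n => s1.
rewrite -!exprD [LHS](_ : _ = (-1) ^+ (1 + (alpha1 W j + alpha1 (W :\ j) i))).
  by rewrite exprD expr1 mulN1r.
by rewrite -s1 !alpha1E addnACA; congr (_ ^+ (_ + _)); rewrite addnC.
Qed.

Lemma extdiff1 : extdiff 1 = 0.
Proof. by rewrite -eps0 extdiff_eps big_set0. Qed.

Lemma extdiff_leibniz d x y : ehomog d x ->
  extdiff (x * y) = extdiff x * y + (-1) ^+ d *: (x * extdiff y).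
Proof.
move: x; apply: extalg_ind => [|c V x /eqP dV _ IHx].
  by rewrite !linear0 !mul0r !linear0 add0r.
rewrite mulrDl !linearD /= IHx !mulrDl scalerDr addrACA; congr (_ + _).
rewrite -!scalerAl !linearZ /= -!scalerAl -scalerDr.
congr (_ *: _) => {x c IHx}.
elim: d V dV => [|d IHd] V dV.
  move/eqP: dV; rewrite cards_eq0 => /eqP->.
  by rewrite eps0 extdiff1 mul0r add0r !mul1r scale1r.
have /card_gt0P[i iV] : (0 < #|V|)%N by rewrite dV.
have dV' : #|V :\ i| = d by move: dV; rewrite (cardsD1 i) iV => -[].
rewrite (eps_setD1 iV) -!scalerAl !linearZ /= -!scalerAl.
rewrite -scalerDr; congr (_ *: _).
rewrite -mulrA 2!extdiff_gen_mul IHd // mulrDr mulrBl opprD addrA.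
rewrite -(mulrA (eps [set i]) _ y) -(mulrA (eps [set i]) _ (extdiff y)).
by congr (_ + _); rewrite exprS mulN1r scaleNr -scalerAr.
Qed.

Lemma extdiffK x : extdiff (extdiff x) = 0.
Proof.
elim/extalg_full_ind: x => [|c V x IHx].
  by rewrite !linear0.
rewrite !(linearD, linearZ) /= IHx add0r => {x IHx}.
suff -> : extdiff (extdiff (eps V)) = 0 by rewrite scaler0.
have [d dV] := ubnP #|V|; elim: d V dV => // d IHd V dV.
have [->|/set0Pn[i iV]] := eqVneq V set0; first by rewrite eps0 extdiff1 linear0.
rewrite (eps_setD1 iV) !linearZ /= extdiff_gen_mul linearB /= extdiff_gen_mul IHd.
  by rewrite mulr0 subr0 subrr scaler0.
by move: dV; rewrite (cardsD1 i) iV.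
Qed.

Lemma ehomog_extdiff d x : ehomog d.+1 x -> ehomog d (extdiff x).
Proof.
move=> hx; apply: supp_in_sum => F _.
have [->|/hx/eqP dF] := eqVneq (x F) 0; first by rewrite scale0r; apply: supp_in0.
apply: supp_inZ; apply: supp_in_sum => i iF; apply: supp_inZ; apply: supp_in_eps.
by move: dF; rewrite (cardsD1 i) iF add1n => -[->].
Qed.

End ExteriorAlgebra.

                                               

(** * Divided powers in the exterior algebra *)

Lemma even_posM k d : (0 < k)%N -> even_pos d -> even_pos (k * d).
Proof.
by rewrite /even_pos => k0 /andP[d0 ed]; rewrite muln_gt0 k0 d0 oddM (negPf ed) andbF.
Qed.

(** The quotient counts partitions of a set into blocks of size h + 1. The binomial factor chooses
    the h companions of a fixed element in the additional block. *)
Lemma dpow_coef_rec h k :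
  (((h.+1 * k.+1)`! %/ (k.+1`! * h.+1`! ^ k.+1)) =
   ((h.+1 * k)`! %/ (k`! * h.+1`! ^ k)) * 'C(h.+1 * k + h, h.+1 * k))%N.
Proof.
have c0 m l : (0 < m`! * h.+1`! ^ l)%N by rewrite muln_gt0 expn_gt0 !fact_gt0.
have step l : ((h.+1 * l.+1)`! =
    (h.+1 * l)`! * 'C(h.+1 * l + h, h.+1 * l) * (l.+1 * h.+1`!))%N.
  rewrite mulnSr addnS factS -addnS -mulnSr.
  by rewrite -(bin_fact (leq_addr h (h.+1 * l))) addKn factS; ring.
(* Exhibiting the quotient shows that the natural number division is exact. *)
have [c ck] : exists c, ((h.+1 * k)`! = c * (k`! * h.+1`! ^ k))%N.
  elim: (k) => [|l [c cl]]; first by exists 1%N; rewrite muln0.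
  exists (c * 'C(h.+1 * l + h, h.+1 * l))%N; rewrite step cl (factS l) expnS; ring.
rewrite ck mulnK // (_ : (h.+1 * k.+1)`! =
  c * 'C(h.+1 * k + h, h.+1 * k) * (k.+1`! * h.+1`! ^ k.+1))%N ?mulnK //.
by rewrite step ck (factS k) expnS; ring.
Qed.

Section DividedPowers.
Variables (R : comNzRingType) (r : nat).
Local Notation E := (extalg R r).
Implicit Types (F G : {set 'I_r}) (x y z : E).

Definition dfactor y : {poly E} := 1 + y%:P * 'X.

(** Generating series of the divided powers: each factor is the exponential series of one term,
    which stops after degree 1 because [eps F] has zero higher divided powers. The list [s] is a
    parameter so that the order of the factors can be changed later. *)
Definition dseries (s : seq {set 'I_r}) x : {poly E} :=
  \prod_(F <- s) dfactor (x F *: eps R F).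

Definition evenp_supp : E -> Prop := supp_in (fun F => even_pos #|F|).

Lemma evenp_even x : evenp_supp x -> even_supp x.
Proof. by move=> ex F /ex/andP[]. Qed.

Lemma ehomog_evenp d x : even_pos d -> ehomog d x -> evenp_supp x.
Proof. by move=> ed hx F /hx/eqP->. Qed.

Lemma ehomog_even d x : ~~ odd d -> ehomog d x -> even_supp x.
Proof. by move=> ed hx F /hx/eqP->. Qed.

Lemma ehomog_eps d (c : R) F : #|F| = d -> ehomog d (c *: eps R F).
Proof. by move=> dF; apply: supp_inZ; apply: supp_in_eps; apply/eqP. Qed.

Lemma evenp_eps (c : R) F : even_pos #|F| -> evenp_supp (c *: eps R F).
Proof. by move=> dF; apply: supp_inZ; apply: supp_in_eps. Qed.

Lemma mul_evenp_eps (c : R) F :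
  even_pos #|F| -> (c *: eps R F) * (c *: eps R F) = 0.
Proof.
move=> /andP[F0 _]; rewrite -scalerAl -scalerAr mul_eps_eps ?scaler0 //.
by rewrite -card_gt0.
Qed.

Lemma coef0_dseries s x : (dseries s x)`_0 = 1.
Proof.
rewrite /dseries; elim/big_rec: _ => [|F p _ p0]; first by rewrite coef1.
by rewrite /dfactor mulrDl mul1r coefD p0 -mulrA -(commr_polyX p) mulrA coefMX addr0.
Qed.

Lemma coefS_mul_dfactor p y k : (p * dfactor y)`_k.+1 = p`_k.+1 + p`_k * y.
Proof. by rewrite /dfactor mulrDr mulr1 mulrA coefD coefMX coefMC. Qed.

Lemma coef_dfactor y k :
  (dfactor y)`_k = if k is k'.+1 then if k' is 0 then y else 0 else 1.
Proof.
rewrite /dfactor coefD coef1 coefMX.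
by case: k => [|[|k]]; rewrite coefC /= ?add0r ?addr0.
Qed.

Lemma dfactorD y z : y * z = 0 -> dfactor (y + z) = dfactor y * dfactor z.
Proof.
move=> yz; apply/polyP => -[|k].
  by rewrite coef0M !coef_dfactor mulr1.
rewrite coefS_mul_dfactor !coef_dfactor.
by case: k => [|[|k]]; rewrite ?mul1r // ?mul0r ?addr0 // yz addr0.
Qed.

Lemma dfactor_comm p y : even_supp y -> GRing.comm p (dfactor y).
Proof.
move=> ey; apply: commrD; first exact: commr1.
apply: commrM; last exact: commr_polyX.
by apply/polyP => k; rewrite coefMC coefCM; apply/commr_sym/even_comm.
Qed.

(** Only the factor at F changes. It splits as a product even when F already occurs in x, because
    the two terms on F multiply to zero; the new factor is central and moves to the end. *)
Lemma dseries_add s x (c : R) F :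
  uniq s -> F \in s -> evenp_supp x -> even_pos #|F| ->
  dseries s (x + c *: eps R F) = dseries s x * dfactor (c *: eps R F).
Proof.
move=> us Fs ex eF; elim: s us Fs => //= G s IHs /andP[Gs us].
rewrite inE /dseries !big_cons -!/(dseries _ _) addeE scaleeE epsE.
have [FG|FG] /= := eqVneq F G; last first.
  by move=> Fs; rewrite mulr0 addr0 IHs // mulrA.
move=> _; rewrite mulr1; subst G.
have -> : dseries s (x + c *: eps R F) = dseries s x.
  apply: eq_big_seq => H Hs; rewrite addeE scaleeE epsE.
  have [HF|] := eqVneq H F; last by rewrite mulr0 addr0.
  by case/negP: Gs; rewrite -HF.
rewrite scalerDl dfactorD; last first.
  have [/ex eF'|/negPn/eqP->] := boolP (x F != 0); last by rewrite scale0r mul0r.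
  by rewrite -scalerAl -scalerAr mul_eps_eps ?scaler0 // -card_gt0; case/andP: eF.
rewrite -!mulrA; congr (_ * _); apply/commr_sym/dfactor_comm.
exact/evenp_even/evenp_eps.
Qed.

Definition dpow x k := (dseries (index_enum {set 'I_r}) x)`_k.

Lemma dseries0 s : dseries s 0 = 1.
Proof.
rewrite /dseries big1 // => F _; rewrite ffunE scale0r.
by rewrite /dfactor polyC0 mul0r addr0.
Qed.

Lemma dpowx0 x : dpow x 0 = 1. Proof. exact: coef0_dseries. Qed.

Lemma dpow0S k : dpow 0 k.+1 = 0. Proof. by rewrite /dpow dseries0 coef1. Qed.

(** The recursion on which the divided power axioms rest. *)
Lemma dpow_addeps x (c : R) F k : evenp_supp x -> even_pos #|F| ->
  dpow (x + c *: eps R F) k.+1 = dpow x k.+1 + dpow x k * (c *: eps R F).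
Proof.
move=> ex eF; rewrite /dpow dseries_add ?index_enum_uniq ?mem_index_enum //.
exact: coefS_mul_dfactor.
Qed.

(** Independence of the enumeration: for any list, the coefficients obey the same recursion from the
    same initial values. *)
Lemma coef_dseries s x k :
  uniq s -> (forall F, F \in s) -> evenp_supp x -> (dseries s x)`_k = dpow x k.
Proof.
move=> us sT ex; elim/extalg_ind: x / ex k => [|c F x eF ex IHx] k.
  by rewrite /dpow !dseries0.
by rewrite /dpow !dseries_add ?index_enum_uniq ?mem_index_enum //;
  case: k => [|k]; rewrite ?coef0M ?coefS_mul_dfactor !IHx.
Qed.

Lemma dpowx1 x : evenp_supp x -> dpow x 1 = x.
Proof.
elim/extalg_ind => [|c F {}x eF ex IHx]; first exact: dpow0S.
by rewrite dpow_addeps // IHx dpowx0 mul1r.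
Qed.

Lemma dpow_ehomog d x k :
  even_pos d -> ehomog d x -> ehomog (k * d) (dpow x k).
Proof.
move=> ed hx; elim/extalg_ind: x / hx k => [|c F x /eqP dF hx IHx] [|k];
  rewrite ?dpowx0 ?dpow0S -?eps0;
  try solve [exact: supp_in0 | by apply: supp_in_eps; rewrite cards0].
rewrite dpow_addeps ?dF //; last exact: ehomog_evenp hx.
apply: supp_inD; first exact: IHx.
by rewrite mulSn addnC; apply: ehomogM; [exact: IHx | exact: ehomog_eps].
Qed.

Lemma dpow_mul x h k : evenp_supp x ->
  dpow x h * dpow x k = dpow x (h + k) *+ 'C(h + k, h).
Proof.
move=> ex; elim/extalg_ind: x / ex h k => [|c F x eF ex IHx] [|h] [|k];
  rewrite ?dpowx0 ?mul1r ?mulr1 ?add0n ?addn0 ?bin0 ?binn ?mulr1n //.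
  by rewrite !dpow0S mul0r mul0rn.
have ez : evenp_supp (c *: eps R F) by exact: evenp_eps.
have zz := mul_evenp_eps c eF.
rewrite addnS addSn !dpow_addeps //; set z := c *: _ in ez zz *.
have cz w : z * w = w * z by apply/even_comm/evenp_even.
(* The z^2 term vanishes, and the coefficients of the two terms linear in z add up by Pascal's
   rule. *)
rewrite mulrDl !mulrDr -!mulrA (cz (dpow x k.+1)) (cz (dpow x k * z)).
rewrite -(mulrA _ z z) zz !mulr0 addr0 !mulrA !IHx !addnS !addSn -addrA -mulrDl.
by rewrite -mulrnDr -binS mulrnDl mulrnAl.
Qed.

Definition dpow_trivial x := forall k, dpow x k.+2 = 0.

Lemma dpow_trivial_eps (c : R) F : even_pos #|F| -> dpow_trivial (c *: eps R F).
Proof.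
move=> eF k; rewrite -[c *: _]add0r dpow_addeps ?dpow0S ?mul0r ?addr0 //.
exact: supp_in0.
Qed.

Lemma dpow_trivial0 : dpow_trivial 0.
Proof. by move=> k; exact: dpow0S. Qed.

Lemma dpow_trivial_mul_eps (c : R) F G :
  even_pos (#|F| + #|G|) -> dpow_trivial (c *: (eps R F * eps R G)).
Proof.
move=> eFG; rewrite mul_eps scalerA /esign.
case: ifP => [dFG|_]; last by rewrite mulr0 scale0r; apply: dpow_trivial0.
by apply: dpow_trivial_eps; rewrite cardsU (disjoint_setI0 dFG) cards0 subn0.
Qed.

Lemma dpow_add x y k : evenp_supp x -> evenp_supp y ->
  dpow (x + y) k = \sum_(j < k.+1) dpow x j * dpow y (k - j).
Proof.
move=> ex ey; elim/extalg_ind: y / ey k => [|c F y eF ey IHy] k.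
  rewrite addr0 big_ord_recr /= subnn dpowx0 mulr1 big1 ?add0r // => j _.
  by rewrite -(subnSK (ltn_ord j)) dpow0S mulr0.
case: k => [|k]; first by rewrite big_ord1 !dpowx0 mulr1.
rewrite addrA dpow_addeps ?IHy //; last exact: supp_inD.
rewrite [X in X + _]big_ord_recr [RHS]big_ord_recr /= subnn !dpowx0 addrAC; congr (_ + _).
rewrite mulr_suml -big_split; apply: eq_bigr => j _ /=.
by rewrite subSn ?dpow_addeps ?mulrDr ?mulrA // -ltnS.
Qed.

Lemma dpow_add_trivial x y k : evenp_supp x -> evenp_supp y ->
  dpow_trivial y -> dpow (x + y) k.+1 = dpow x k.+1 + dpow x k * y.
Proof.
move=> ex ey ty; rewrite dpow_add // !big_ord_recr /= subnn subSn // subnn.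
rewrite dpowx0 mulr1 dpowx1 // big1 ?add0r 1?addrC // => j _.
by rewrite subSn 1?ltnW // -(subnSK (ltn_ord j)) ty mulr0.
Qed.

Lemma dpow_trivialD x y : evenp_supp x -> evenp_supp y -> x * y = 0 ->
  dpow_trivial x -> dpow_trivial y -> dpow_trivial (x + y).
Proof.
move=> ex ey xy tx ty k; rewrite dpow_add_trivial // tx add0r.
by case: k => [|k]; rewrite ?dpowx1 ?tx ?mul0r.
Qed.

Lemma ehomog_evenpM d e x y :
  even_pos (d + e) -> ehomog d x -> ehomog e y -> evenp_supp (x * y).
Proof. by move=> ede hx hy; apply: ehomog_evenp ede _; apply: ehomogM. Qed.

(** Both factors are expanded into monomials. Any two summands multiply to zero, since an odd
    element occurs twice in their product, so [dpow_trivialD] adds them up. *)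
Lemma dpow_trivial_mul_odd d e x y : odd d -> odd e ->
  ehomog d x -> ehomog e y -> dpow_trivial (x * y).
Proof.
move=> od oe hx hy.
have ede : even_pos (d + e) by rewrite /even_pos addn_gt0 odd_gt0 // oddD od oe.
elim/extalg_ind: x / hx => [|c F x /eqP dF hx IHx].
  by rewrite mul0r; apply: dpow_trivial0.
have hF : ehomog d (c *: eps R F) by apply: ehomog_eps.
rewrite mulrDl; apply: dpow_trivialD => //; try exact: ehomog_evenpM ede _ _.
  rewrite -mulrA (mulrA y) (ehomog_mulC hy hF) -scalerAl -(mulrA _ y).
  by rewrite (ehomog_sqr_odd oe hy) mulr0 scaler0 mulr0.
elim/extalg_ind: y / hy {IHx} => [|c' G y /eqP eG hy IHy].
  by rewrite mulr0; apply: dpow_trivial0.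
have hG : ehomog e (c' *: eps R G) by apply: ehomog_eps.
rewrite mulrDr; apply: dpow_trivialD => //; try exact: ehomog_evenpM ede _ _.
  move: (c *: eps R F) (c' *: eps R G) hF {IHy hG} => X Y hF.
  rewrite -mulrA (mulrA y) (ehomog_mulC hy hF) -scalerAl -(mulrA _ y) -scalerAr.
  by rewrite !mulrA (ehomog_sqr_odd od hF) !mul0r scaler0.
by rewrite -scalerAl -scalerAr scalerA; apply: dpow_trivial_mul_eps; rewrite dF eG.
Qed.

Lemma dpow_mul_even d e x y k : ~~ odd d -> even_pos e ->
  ehomog d x -> ehomog e y -> dpow (x * y) k = x ^+ k * dpow y k.
Proof.
move=> ed ee hx hy.
have ede : even_pos (d + e).
  by case/andP: ee => e0 ee; rewrite /even_pos addn_gt0 e0 orbT oddD (negPf ed).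
have cx w : x * w = w * x by apply/even_comm; apply: ehomog_even hx.
elim/extalg_ind: y / hy k => [|c F y /eqP eF hy IHy] k.
  rewrite mulr0; case: k => [|k]; first by rewrite !dpowx0 mulr1.
  by rewrite !dpow0S mulr0.
have hF : ehomog e (c *: eps R F) by apply: ehomog_eps.
(* The case where y is a single monomial: from j = 2 on both sides vanish, as the square of the
   monomial is zero. The sum formula then extends it to all y. *)
have step j : dpow (x * (c *: eps R F)) j = x ^+ j * dpow (c *: eps R F) j.
  case: j => [|[|j]]; first by rewrite !dpowx0 mulr1.
    rewrite expr1 !dpowx1 //; first exact: ehomog_evenp hF.
    exact: ehomog_evenpM ede _ _.
  rewrite dpow_trivial_eps ?eF // mulr0; move: j.
  elim/extalg_ind: x / hx {IHy cx} => [|c' G x /eqP dG hx IHx].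
    by rewrite mul0r; apply: dpow_trivial0.
  have hG : ehomog d (c' *: eps R G) by apply: ehomog_eps.
  rewrite mulrDl; apply: dpow_trivialD => //; try exact: ehomog_evenpM ede _ _.
    have eF' : even_pos #|F| by rewrite eF.
    have -> : (c' *: eps R G) * (c *: eps R F) = (c *: eps R F) * (c' *: eps R G).
      by apply/commr_sym/even_comm; apply: ehomog_even hF; case/andP: ee.
    by rewrite -mulrA (mulrA (c *: _)) mul_evenp_eps // mul0r mulr0.
  by rewrite -scalerAl -scalerAr scalerA; apply: dpow_trivial_mul_eps; rewrite dG eF.
rewrite mulrDr !dpow_add; try exact: ehomog_evenpM ede _ _.
  2,3: by apply: ehomog_evenp ee _.
rewrite mulr_sumr; apply: eq_bigr => j _; rewrite IHy step mulrA -(mulrA (x ^+ j)).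
rewrite (commrX (k - j) (_ : GRing.comm (dpow y j) x)) //.
by rewrite mulrA -exprD subnKC -1?ltnS // mulrA.
Qed.

Lemma dpow_dpow d x h k : even_pos d -> ehomog d x ->
  dpow (dpow x h.+1) k =
    dpow x (h.+1 * k) *+ ((h.+1 * k)`! %/ (k`! * h.+1`! ^ k)).
Proof.
move=> ed hx; elim/extalg_ind: x / hx h k => [|c F x /eqP dF hx IHx] h k.
  rewrite dpow0S; case: k => [|k]; last by rewrite dpow0S mulnS addSn dpow0S mul0rn.
  by rewrite dpowx0 muln0 dpowx0 fact0 expn0 muln1 divn1 mulr1n.
have ex : evenp_supp x by apply: ehomog_evenp hx.
have eF : even_pos #|F| by rewrite dF.
have hF : ehomog d (c *: eps R F) by apply: ehomog_eps.
have ez : evenp_supp (c *: eps R F) by apply: ehomog_evenp hF.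
case: k => [|k].
  by rewrite muln0 !dpowx0 fact0 expn0 muln1 divn1 mulr1n.
have [hd ehd] : ~~ odd (h * d) /\ even_pos (h * d + d).
  by move: ed => /andP[d0 /negPf ed]; rewrite /even_pos addn_gt0 d0 orbT oddD oddM ed andbF.
have hh : ehomog (h * d) (dpow x h) by apply: dpow_ehomog.
(* The increment x^(h) z has trivial divided powers because z does, so the outer power also grows by
   a single term; its coefficient is matched by [dpow_coef_rec]. *)
rewrite [dpow (x + _) h.+1]dpow_addeps // dpow_add_trivial; first last.
- case: h IHx hd ehd hh => [|h] IHx hd ehd hh j.
    by rewrite dpowx0 mul1r dpow_trivial_eps.
  by rewrite (dpow_mul_even _ hd ed hh hF) dpow_trivial_eps // mulr0.
- exact: ehomog_evenpM ehd _ _.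
- apply: (@ehomog_evenp (h.+1 * d)); first exact: even_posM.
  exact: dpow_ehomog.
rewrite !IHx dpow_coef_rec; move: (_ %/ _)%N => N.
rewrite mulnSr addnS dpow_addeps // mulrnDl; congr (_ + _).
by rewrite mulrA mulrnAl dpow_mul // -mulrnA mulrnAl [(N * _)%N]mulnC.
Qed.

(** A surviving term would need F disjoint from F minus a point, hence F a singleton, which even
    size forbids. *)
Lemma mul_eps_diff (c : R) F : even_pos #|F| ->
  (c *: eps R F) * extdiff (c *: eps R F) = 0.
Proof.
move=> eF; rewrite linearZ /= -scalerAl -scalerAr extdiff_eps mulr_sumr.
rewrite big1 ?scaler0 // => i iF; rewrite -scalerAr mul_eps /esign.
case: ifP => [dF|_]; last by rewrite scale0r scaler0.
have := cardsD1 i F; rewrite iF => cF.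
have F1 : F :\ i = set0.
  apply/setP => j; rewrite [RHS]inE; apply: contraTF dF => jFi.
  by apply/negP => /disjointFl/(_ jFi); move: jFi; rewrite !inE => /andP[_ ->].
by move: eF; rewrite cF F1 cards0.
Qed.

Lemma extdiff_dpow d x k : even_pos d -> ehomog d x ->
  extdiff (dpow x k.+1) = dpow x k * extdiff x.
Proof.
move=> ed hx; elim/extalg_ind: x / hx k => [|c F x /eqP dF hx IHx] k.
  by rewrite dpow0S linear0 mulr0.
have ex : evenp_supp x by apply: ehomog_evenp hx.
have eF : even_pos #|F| by rewrite dF.
have hF : ehomog d (c *: eps R F) by apply: ehomog_eps.
have hk : ehomog (k * d) (dpow x k) by apply: dpow_ehomog.
have ekd : odd (k * d) = false.
  by case/andP: ed => _ /negPf ed; rewrite oddM ed andbF.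
rewrite dpow_addeps // linearD /= IHx (extdiff_leibniz _ hk) -signr_odd ekd scale1r.
rewrite linearD /=; case: k hk ekd => [|k] hk ekd.
  by rewrite !dpowx0 extdiff1 mul0r add0r !mul1r.
rewrite IHx dpow_addeps // mulrDl !mulrDr -!(mulrA _ (c *: _)) mul_eps_diff // mulr0 addr0.
rewrite -[RHS]addrA; congr (_ + _); rewrite addrC; congr (_ + _).
rewrite -mulrA; congr (_ * _). apply/commr_sym/even_comm.
by apply: ehomog_even hF; case/andP: ed.
Qed.

End DividedPowers.

                                                          

(** * Multidegrees inside the exterior algebra *)

Section MonomialCoefficients.
Variables (K : fieldType) (n r : nat).
Local Notation P := {mpoly K[n]}.
Local Notation E := (extalg P r).
Implicit Types (m p : 'X_{1..n}) (a b : P) (x y : E).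

Definition is_term m a := exists c : K, a = c%:MP * 'X_[m].

Lemma is_term0 m : is_term m 0.
Proof. by exists 0; rewrite mul0r. Qed.

Lemma is_termD m a b : is_term m a -> is_term m b -> is_term m (a + b).
Proof. by move=> [c ->] [d ->]; exists (c + d); rewrite mpolyCD mulrDl. Qed.

Lemma is_termM m p a b : is_term m a -> is_term p b -> is_term (m + p)%MM (a * b).
Proof.
move=> [c ->] [d ->]; exists (c * d); rewrite mpolyCM mpolyXD.
by rewrite -!mulrA; congr (_ * _); rewrite mulrCA.
Qed.

Lemma is_term_sign k : is_term 0%MM ((-1) ^+ k).
Proof. by exists ((-1) ^+ k); rewrite mpolyX0 mulr1 rmorphXn /= rmorphN1. Qed.

Lemma is_term_esign V W : is_term 0%MM (esign P (r := r) V W).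
Proof. by rewrite /esign; case: ifP => _; [exact: is_term_sign | exact: is_term0]. Qed.

(** Multihomogeneity when every [eps F] is given multidegree zero; this is what multidegree m
    becomes under [embed]. *)
Definition mono_coef m x := forall F, is_term m (x F).

Lemma mono_coef0 m : mono_coef m 0.
Proof. by move=> F; rewrite ffunE; apply: is_term0. Qed.

Lemma mono_coefD m x y : mono_coef m x -> mono_coef m y -> mono_coef m (x + y).
Proof. by move=> hx hy F; rewrite addeE; apply: is_termD. Qed.

Lemma mono_coef_sum m (I : Type) (s : seq I) (Q : pred I) (f : I -> E) :
  (forall k, Q k -> mono_coef m (f k)) -> mono_coef m (\sum_(k <- s | Q k) f k).
Proof.
by move=> h; apply: big_ind => //; [exact: mono_coef0 | exact: mono_coefD].
Qed.

Lemma mono_coef_eps m a F : is_term m a -> mono_coef m (a *: eps P F).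
Proof.
move=> ta G; rewrite scaleeE epsE; case: eqP => _; rewrite ?mulr1 ?mulr0 //.
exact: is_term0.
Qed.

Lemma mono_coefM m p x y :
  mono_coef m x -> mono_coef p y -> mono_coef (m + p)%MM (x * y).
Proof.
move=> hx hy; rewrite extmul_suppE.
apply: mono_coef_sum => V _; apply: mono_coef_sum => W _; apply: mono_coef_eps.
by rewrite -[(m + p)%MM]addm0; apply: is_termM (is_term_esign V W); apply: is_termM.
Qed.

Lemma mono_coef_extdiff m x : mono_coef m x -> mono_coef m (extdiff x).
Proof.
move=> hx; apply: mono_coef_sum => F _; rewrite scaler_sumr.
apply: mono_coef_sum => i _; rewrite scalerA; apply: mono_coef_eps.
by rewrite -[m]addm0; apply: is_termM (is_term_sign _).
Qed.

Lemma mono_coef_dpow m x k : mono_coef m x -> mono_coef (m *+ k)%MM (dpow x k).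
Proof.
move=> hx; rewrite /dpow /dseries; elim: index_enum k => [|F s IHs] k.
  rewrite big_nil coef1; case: k => [|k]; last exact: mono_coef0.
  by rewrite mulm0n -eps0 -[eps _ _]scale1r; apply: mono_coef_eps; apply: (is_term_sign 0).
rewrite big_cons /dfactor mulrDl mul1r -mulrA -(commr_polyX (\prod_(j <- s) _)).
rewrite coefD coefCM coefMX; case: k => [|k] /=.
  by rewrite mulr0 addr0; apply: IHs.
apply: mono_coefD; first exact: IHs.
by rewrite mulmS; apply: mono_coefM => //; apply: mono_coef_eps.
Qed.

End MonomialCoefficients.

(** * Divisibility of least common multiples, which makes the truncated monomial subtractions
    exact *)

Section LcmOfSets.
Variables (n r : nat) (u : 'I_r -> 'X_{1..n}).
Implicit Types F G V W : {set 'I_r}.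

Lemma mlcm_setE F k : mlcm_set u F k = \max_(j in F) u j k.
Proof.
rewrite /mlcm_set (big_morph (fun m : 'X_{1..n} => m k) (id1 := 0%N) (op1 := maxn)) //.
  by move=> m p; rewrite mnmE.
by rewrite mnm0E.
Qed.

Lemma mlcm_set_sub F G : F \subset G -> (mlcm_set u F <= mlcm_set u G)%MM.
Proof.
move=> /subsetP sFG; apply/mnm_lepP => k; rewrite !mlcm_setE.
by apply/bigmax_leqP => j /sFG jG; apply: (leq_bigmax_cond (F := fun j => u j k)).
Qed.

Lemma mlcm_setU V W : (mlcm_set u (V :|: W) <= mlcm_set u V + mlcm_set u W)%MM.
Proof.
apply/mnm_lepP => k; rewrite mnmDE !mlcm_setE; apply/bigmax_leqP => j.
have h F : j \in F -> (u j k <= \max_(l in F) u l k)%N.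
  by move=> jF; apply: (leq_bigmax_cond (F := fun j => u j k)).
rewrite inE => /orP[/h|/h] /leq_trans-> //; [exact: leq_addr | exact: leq_addl].
Qed.

Lemma mlcm_set0 : mlcm_set u set0 = 0%MM.
Proof. exact: big_set0. Qed.

End LcmOfSets.

Lemma mcoeffMX_le (K : fieldType) (n : nat) (a : {mpoly K[n]}) m p :
  (a * 'X_[m])@_p != 0 -> (m <= p)%MM.
Proof.
apply: contraR => nmp; rewrite (mpolyE a) mulr_suml raddf_sum big1 //= => s _.
rewrite -scalerAl -mpolyXD mcoeffZ mcoeffX; case: eqP => [sp|]; last by rewrite mulr0.
by rewrite -sp lem_addl in nmp.
Qed.

(** * Embedding algebras with Taylor structure constants into the exterior algebra *)

Record taylor_like (K : fieldType) (n r : nat) (u : 'I_r -> 'X_{1..n})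
    (S : struct_consts K n) (beta : sc_basis S -> {set 'I_r}) : Prop := {
  tl_bij : bijective beta;
  tl_hdeg : forall b : sc_basis S, sc_hdeg b = #|beta b|;
  tl_mdeg : forall b : sc_basis S, sc_mdeg b = mlcm_set u (beta b);
  tl_unit : beta (sc_unit S) = set0;
  tl_diff : forall g a : sc_basis S,
    sc_diff g a = @sc_diff K n (taylor_consts K u) (beta g) (beta a);
  tl_mul : forall g h a : sc_basis S,
    sc_mul g h a = @sc_mul K n (taylor_consts K u) (beta g) (beta h) (beta a);
  tl_dpow : forall (g : sc_basis S) k a, sc_dpow g k.+2 a = 0
}.

Section Embedding.
Variables (K : fieldType) (n r : nat) (u : 'I_r -> 'X_{1..n}).
Variables (S : struct_consts K n) (beta : sc_basis S -> {set 'I_r}).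
Hypothesis tlS : taylor_like u beta.
Local Notation P := {mpoly K[n]}.
Local Notation E := (extalg P r).
Local Notation A := (dgg_of S).
Local Notation M := (freemod K n (sc_basis S)).
Local Notation m_ b := (mlcm_set u (beta b)).
Implicit Types (x y : A) (b g h a : sc_basis S).

(** Weighting each basis element by its own multidegree absorbs every monomial coefficient of the
    structure. The image is in general a proper submodule; only injectivity is needed to pull
    identities back. *)
Definition embed (x : A) : E :=
  \sum_b ((x : M) b * 'X_[m_ b]) *: eps P (beta b).

Lemma embed_linear : linear embed.
Proof.
move=> c x y; rewrite /embed scaler_sumr -big_split; apply: eq_bigr => b _ /=.
by rewrite !ffunE scalerA -scalerDl mulrA -mulrDl.
Qed.

HB.instance Definition _ := GRing.isLinear.Build P A E _ embed embed_linear.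

Lemma embedE x b : embed x (beta b) = (x : M) b * 'X_[m_ b].
Proof.
by rewrite /embed sum_epsE //; apply: bij_inj (tl_bij tlS).
Qed.

Lemma mulIX (m : 'X_{1..n}) : injective (fun p : P => p * 'X_[m]).
Proof.
apply: mulIf; apply/eqP => /(congr1 (mcoeff m)); rewrite mcoeffX eqxx mcoeff0.
by apply/eqP; apply: oner_neq0.
Qed.

Lemma embed_inj : injective embed.
Proof.
move=> x y exy; apply/ffunP => b; apply: (@mulIX (m_ b)) => /=.
by rewrite -!embedE exy.
Qed.

Lemma beta_surj F : exists b, F = beta b.
Proof. by have [g _ gK] := tl_bij tlS; exists (g F); rewrite gK. Qed.

Lemma embed_ebasis b : embed (ebasis K n b) = 'X_[m_ b] *: eps P (beta b).
Proof.
rewrite /embed (bigD1 b) //= big1 ?addr0 => [|c cb].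
  by rewrite ffunE eqxx mul1r.
by rewrite ffunE (negPf cb) mul0r scale0r.
Qed.

Lemma embed_one : embed (dg_one A) = 1.
Proof.
by rewrite /= embed_ebasis (tl_unit tlS) mlcm_set0 mpolyX0 scale1r eps0.
Qed.

Lemma sum_beta F (c : P) (k : sc_basis S -> P) b0 : beta b0 = F ->
  (forall b, b != b0 -> k b = 0) -> k b0 = c ->
  \sum_b k b *: eps P (beta b) = c *: eps P F.
Proof.
move=> <- k0 <-; rewrite (bigD1 b0) //= big1 ?addr0 // => b nb.
by rewrite k0 // scale0r.
Qed.

Lemma embed_mul x y : embed (dg_mul x y) = embed x * embed y.
Proof.
transitivity (\sum_a \sum_g \sum_h ((x : M) g * (y : M) h *
    ((sc_mul g h a)%:MP * 'X_[(sc_mdeg g + sc_mdeg h - sc_mdeg a)%MM]) * 'X_[m_ a])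
    *: eps P (beta a)).
  apply: eq_bigr => a _.
  rewrite [dg_mul x y]/=.
  rewrite [X in X * _]ffunE.
  rewrite mulr_suml scaler_suml.
  apply: eq_bigr => g _.
  by rewrite mulr_suml scaler_suml.
rewrite exchange_big [in RHS]/embed mulr_suml.
apply: eq_bigr => g _.
rewrite exchange_big mulr_sumr.
apply: eq_bigr => h _ /=.
rewrite -scalerAl -scalerAr scalerA mul_eps scalerA.
have [b0 b0E] := beta_surj (beta g :|: beta h).
apply: (sum_beta (b0 := b0)) => // [b nb|]; rewrite (tl_mul tlS) /=.
  rewrite b0E (inj_eq (bij_inj (tl_bij tlS))) (negPf nb) andbF.
  by rewrite mpolyC0 mul0r mulr0 mul0r.
rewrite b0E eqxx andbT /esign; case: ifP => _; last first.
  by rewrite mpolyC0 mul0r !mulr0 mul0r.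
rewrite !(tl_mdeg tlS) rmorphXn rmorphN1 -!mulrA -mpolyXD submK; last first.
  by rewrite -b0E; apply: mlcm_setU.
by rewrite mpolyXD; ring.
Qed.

Lemma embed_diff x : embed (dg_diff x) = extdiff (embed x).
Proof.
rewrite {2}/embed linear_sum /=.
transitivity (\sum_a \sum_g ((x : M) g *
    ((sc_diff g a)%:MP * 'X_[(sc_mdeg g - sc_mdeg a)%MM]) * 'X_[m_ a])
    *: eps P (beta a)).
  apply: eq_bigr => a _.
  by rewrite [X in X * _]ffunE mulr_suml scaler_suml.
rewrite exchange_big /=; apply: eq_bigr => g _.
rewrite linearZ /= extdiff_eps scaler_sumr.
transitivity (\sum_a \sum_(i in beta g) ((x : M) g * (((-1) ^+ alpha1 (beta g) i *
    (beta a == beta g :\ i)%:R)%:MP * 'X_[(sc_mdeg g - sc_mdeg a)%MM]) * 'X_[m_ a])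
    *: eps P (beta a)).
  apply: eq_bigr => a _.
  by rewrite (tl_diff tlS) /= rmorph_sum mulr_suml mulr_sumr mulr_suml scaler_suml.
rewrite exchange_big; apply: eq_bigr => i ig /=.
have [b0 b0E] := beta_surj (beta g :\ i).
rewrite scalerA; apply: (sum_beta (b0 := b0)) => // [b nb|].
  by rewrite b0E (inj_eq (bij_inj (tl_bij tlS))) (negPf nb) mulr0 mpolyC0 mul0r mulr0 mul0r.
rewrite b0E eqxx mulr1 !(tl_mdeg tlS) rmorphXn rmorphN1 -!mulrA -mpolyXD submK.
  by rewrite [RHS]mulrCA [RHS]mulrC -mulrA mulrC.
by rewrite -b0E; apply: mlcm_set_sub; apply: subD1set.
Qed.

Lemma embed_dpow_factor x b j :
  embed (((x : M) b ^+ j) *: basis_dpow b j : A) =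
  if j is j'.+1 then if j' is 0 then embed x (beta b) *: eps P (beta b) else 0 else 1.
Proof.
rewrite linearZ /=; case: j => [|[|j]] /=.
- by rewrite expr0 scale1r embed_one.
- by rewrite expr1 embed_ebasis scalerA embedE.
rewrite /embed big1 ?scaler0 // => c _.
by rewrite ffunE (tl_dpow tlS) mpolyC0 !mul0r scale0r.
Qed.

Lemma prod_polyC_Xn (T : nzRingType) (I : Type) (s : seq I) (c : I -> T) (e : I -> nat) :
  \prod_(i <- s) ((c i)%:P * 'X^(e i)) = (\prod_(i <- s) c i)%:P * 'X^(\sum_(i <- s) e i).
Proof.
elim: s => [|i s IHs]; first by rewrite !big_nil mul1r expr0.
rewrite !big_cons IHs polyCM exprD -!mulrA; congr (_ * _).
by rewrite !mulrA -(commr_polyXn _ (e i)).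
Qed.

(** The sum over exponent families defining [ext_dpow] is the coefficient of X^k in a product of
    one-variable series, which becomes [dseries] over the basis order transported by [beta]. *)
Lemma embed_dpow x k : evenp_supp (embed x) -> embed (dg_dpow x k) = dpow (embed x) k.
Proof.
move=> ex; have [g gK Kg] := tl_bij tlS.
rewrite -(@coef_dseries _ _ (map beta (index_enum (sc_basis S)))) //; last first.
- by move=> F; rewrite -(Kg F) map_f ?mem_index_enum.
- by rewrite (map_inj_uniq (bij_inj (tl_bij tlS))) index_enum_uniq.
pose f b j := embed (((x : M) b ^+ j) *: basis_dpow b j : A).
have fE b j : f b j = if j is j'.+1 then
    if j' is 0 then embed x (beta b) *: eps P (beta b) else 0 else 1.
  exact: embed_dpow_factor.
transitivity ((\prod_b \sum_(j < k.+1) ((f b j)%:P * 'X^j))`_k); last first.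
  (* For k = 0 the inner sum stops at j = 0, so its factors lack the linear term of [dfactor] and
     only the constant coefficients are compared. *)
  rewrite /dseries big_map; case: k => [|k].
    rewrite (eq_bigr (fun=> 1)) ?big1_eq ?coef1 => [|b _]; last first.
      by rewrite big_ord1 fE expr0 mulr1.
    by symmetry; have := coef0_dseries (map beta (index_enum (sc_basis S))) (embed x);
      rewrite /dseries big_map.
  congr ((polyseq _)`_k.+1); apply: eq_bigr => b _.
  rewrite !big_ord_recl /= !fE expr0 mulr1 expr1 big1 ?addr0 // => j _.
  by rewrite fE mul0r.
(* Distributing the product gives one summand per exponent family; extracting the coefficient keeps
   the families with sum k. *)
rewrite bigA_distr_bigA coef_sum /= /ext_dpow linear_sum /= big_mkcond /=.
apply: eq_bigr => kk _; rewrite prod_polyC_Xn coefCM coefXn eq_sym.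
case: ifP => _; rewrite ?mulr0 // mulr1.
by rewrite (big_morph embed embed_mul embed_one).
Qed.

Lemma embed_exp x k : embed (dg_exp x k) = embed x ^+ k.
Proof.
by elim: k => [|k IHk]; rewrite ?embed_one // exprS -IHk -embed_mul.
Qed.

Lemma embed_homogeneous i x : homogeneous i x <-> ehomog i (embed x).
Proof.
split=> [hx F|hx b xb].
  have [b ->] := beta_surj F; rewrite embedE -(tl_hdeg tlS) => nz.
  by apply/eqP/hx; apply: contraNneq nz => ->; rewrite mul0r.
rewrite /= (tl_hdeg tlS); apply/eqP/hx; rewrite embedE.
by apply: contraNneq xb => xb; apply/eqP; apply: (@mulIX (m_ b)); rewrite /= xb mul0r.
Qed.

Lemma embed_bihomogeneous i m x :
  bihomogeneous i m x <-> ehomog i (embed x) /\ mono_coef m (embed x).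
Proof.
split=> [hx|[hx tx] b xb].
  split; first by apply/embed_homogeneous => b /hx[].
  move=> F; have [b ->] := beta_surj F; rewrite embedE.
  have [->|/hx[_]] := eqVneq ((x : M) b) 0; first by rewrite mul0r; apply: is_term0.
  rewrite /= (tl_mdeg tlS) => le_m [c ->]; exists c.
  by rewrite -mulrA -mpolyXD submK.
have [c xc] := tx (beta b); rewrite embedE in xc.
(* The nonzero coefficient is a multiple of X^(m_b) and a scalar times X^m, so the first monomial
   divides the second. *)
have le_m : (m_ b <= m)%MM.
  apply: (@mcoeffMX_le _ _ ((x : M) b)); rewrite xc mcoeffCM mcoeffX eqxx mulr1.
  apply: contraNneq xb => c0; apply/eqP; apply: (@mulIX (m_ b)).
  by rewrite /= xc c0 mpolyC0 !mul0r.
split; first by move/embed_homogeneous: hx; apply.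
  by rewrite /= (tl_mdeg tlS).
exists c; apply: (@mulIX (m_ b)); rewrite /= (tl_mdeg tlS).
by rewrite [LHS]xc -mulrA -mpolyXD submK.
Qed.

End Embedding.

(** * The DG Gamma axioms, pulled back along the embedding *)

Section TaylorLikeAlgebra.
Variables (K : fieldType) (n r : nat) (u : 'I_r -> 'X_{1..n}).
Variables (S : struct_consts K n) (beta : sc_basis S -> {set 'I_r}).
Hypothesis tlS : taylor_like u beta.
Local Notation A := (dgg_of S).
Local Notation embed := (embed u beta).
Let embedI := embed_inj tlS.
Let embedM := embed_mul tlS.
Let embedD := embed_diff tlS.
Let embed1 := embed_one tlS.
Let embedP := embed_dpow tlS.
Let embedB := embed_bihomogeneous tlS.
Let embedH := embed_homogeneous tlS.

Lemma embed_lin c (x y : A) : embed (c *: x + y) = c *: embed x + embed y.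
Proof. exact: linearP. Qed.

Lemma taylor_like_dg : is_dg_algebra A.
Proof.
split.
- by move=> c x y; apply: embedI; rewrite !(embed_lin, embedD) linearP.
- move=> i m x /embedB[hx tx]; apply/embedB; rewrite embedD; split.
    exact: ehomog_extdiff.
  exact: mono_coef_extdiff.
- move=> m x /embedB[hx _]; apply: embedI; rewrite embedD linear0.
  (* In degree 0 only the empty set occurs, and the differential kills the unit. *)
  move: (embed x) hx; apply: extalg_ind => [|c F z /eqP F0 _ IHz].
    exact: linear0.
  move/eqP: F0; rewrite cards_eq0 => /eqP->.
  by rewrite linearD linearZ /= IHz eps0 extdiff1 scaler0 addr0.
- by move=> x; apply: embedI; rewrite !embedD extdiffK linear0.
- by move=> x c y z; apply: embedI; rewrite !(embed_lin, embedM) mulrDr scalerAr.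
- by move=> y c x z; apply: embedI; rewrite !(embed_lin, embedM) mulrDl scalerAl.
- by move=> x y z; apply: embedI; rewrite !embedM mulrA.
- by move=> x; apply: embedI; rewrite embedM embed1 mul1r.
- by move=> x; apply: embedI; rewrite embedM embed1 mulr1.
- apply/embedB; rewrite embed1 -eps0; split.
    by apply: supp_in_eps; rewrite cards0.
  by rewrite -[eps _ _]scale1r; apply: mono_coef_eps; apply: (is_term_sign _ _ 0).
- move=> i j m p x y /embedB[hx tx] /embedB[hy ty]; apply/embedB; rewrite embedM; split.
    exact: ehomogM.
  exact: mono_coefM.
- move=> i j a b /embedH ha _; apply: embedI.
  by rewrite linearD linearZ /= !(embedM, embedD) (extdiff_leibniz _ ha).
- move=> i j a b /embedH ha /embedH hb; apply: embedI.
  by rewrite linearZ /= 2!embedM; apply: ehomog_mulC.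
- move=> i a oi /embedH ha; apply: embedI.
  by rewrite linear0 embedM (ehomog_sqr_odd oi ha).
Qed.

Lemma bihomogeneous_evenp i m (x : A) :
  even_pos i -> bihomogeneous i m x -> evenp_supp (embed x).
Proof. by move=> ei /embedB[hx _]; apply: ehomog_evenp hx. Qed.

Lemma taylor_like_dgg : is_dgg_algebra A.
Proof.
split; first exact: taylor_like_dg.
- move=> i m x ei /(bihomogeneous_evenp ei) ex; apply: embedI.
  by rewrite embedP // dpowx0 embed1.
- move=> i m x ei /(bihomogeneous_evenp ei) ex; apply: embedI.
  by rewrite embedP // dpowx1.
- move=> i m x k ei hx; have ex := bihomogeneous_evenp ei hx.
  move/embedB: hx => [hx tx]; apply/embedB; rewrite embedP //; split.
    exact: dpow_ehomog.
  exact: mono_coef_dpow.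
- move=> i m x h k ei /(bihomogeneous_evenp ei) ex; apply: embedI.
  by rewrite raddfMn /= embedM !embedP // dpow_mul.
- move=> i m x y k ei /(bihomogeneous_evenp ei) ex /(bihomogeneous_evenp ei) ey.
  have pxy : embed (x + y) = embed x + embed y by apply: linearD.
  have exy : evenp_supp (embed (x + y)).
    by rewrite pxy; exact: (supp_inD ex ey).
  apply: embedI; rewrite embedP // pxy dpow_add // linear_sum; apply: eq_bigr => j _.
  transitivity (embed (dg_dpow x j) * embed (dg_dpow y (k - j))).
    rewrite (embedP _ ex).
    by rewrite (embedP _ ey).
  symmetry.
  exact: embedM.
- move=> i j m p x y k oi oj /embedB[hx _] /embedB[hy _] k2; apply: embedI.
  have eij : even_pos (i + j) by rewrite /even_pos addn_gt0 odd_gt0 // oddD oi oj.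
  rewrite embedP embedM ?linear0; last exact: ehomog_evenpM eij _ _.
  case: k k2 => [|[|k]] // _.
  exact: (dpow_trivial_mul_odd oi oj hx hy).
- move=> i j m p x y k ei ej hx /[dup] /(bihomogeneous_evenp ej) ey /embedB[hy _] k2.
  move/embedB: hx => [hx _]; apply: embedI.
  have eij : even_pos (i + j).
    by case/andP: ej => j0 ej; rewrite /even_pos addn_gt0 j0 orbT oddD (negPf ei).
  rewrite embedP embedM; last exact: ehomog_evenpM eij _ _.
  by rewrite embedM (embed_exp tlS) embedP // (dpow_mul_even _ ei ej hx hy).
- move=> i m x [|h] k // ei /[dup] /(bihomogeneous_evenp ei) ex /embedB[hx _] _.
  apply: embedI; rewrite raddfMn /= !embedP //.
    exact: dpow_dpow hx.
  by apply: (@ehomog_evenp _ _ (h.+1 * i)); [exact: even_posM | exact: dpow_ehomog].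
- move=> i m x [|k] // ei /[dup] /(bihomogeneous_evenp ei) ex /embedB[hx _] _.
  by apply: embedI; rewrite embedD embedM !embedP // embedD (extdiff_dpow _ ei hx).
Qed.

End TaylorLikeAlgebra.

(** * The isomorphism, and the comparison of structure constants *)

Section TaylorLikeIso.
Variables (K : fieldType) (n r : nat) (u : 'I_r -> 'X_{1..n}).

(** The embeddings are injective and compatible with all the structure, so a map over the exterior
    algebra respects the structure automatically. *)
Lemma is_dgg_map_embed (S1 S2 : struct_consts K n)
    (b1 : sc_basis S1 -> {set 'I_r}) (b2 : sc_basis S2 -> {set 'I_r})
    (f : dgg_of S1 -> dgg_of S2) :
  taylor_like u b1 -> taylor_like u b2 ->
  (forall x, embed u b2 (f x) = embed u b1 x) -> is_dgg_map f.
Proof.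
move=> t1 t2 fE; have inj2 := embed_inj t2; split.
- by move=> c x y; apply: inj2; rewrite fE !linearP /= !fE.
- by move=> i m x /(embed_bihomogeneous t1) hx; apply/(embed_bihomogeneous t2); rewrite fE.
- by move=> x; apply: inj2; rewrite fE (embed_diff t1) (embed_diff t2) fE.
- by apply: inj2; rewrite fE (embed_one t1) (embed_one t2).
- by move=> x y; apply: inj2; rewrite fE (embed_mul t1) (embed_mul t2) !fE.
move=> i m x k ei /(bihomogeneous_evenp t1 ei) ex; apply: inj2.
by rewrite fE (embed_dpow t1) // (embed_dpow t2) fE.
Qed.

Lemma taylor_like_iso (S1 S2 : struct_consts K n)
    (b1 : sc_basis S1 -> {set 'I_r}) (b2 : sc_basis S2 -> {set 'I_r}) :
  taylor_like u b1 -> taylor_like u b2 ->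
  dgg_isomorphic (dgg_of S1) (dgg_of S2).
Proof.
move=> t1 t2.
suff ex (T1 T2 : struct_consts K n) (c1 : sc_basis T1 -> {set 'I_r})
    (c2 : sc_basis T2 -> {set 'I_r}) : taylor_like u c1 -> taylor_like u c2 ->
    exists f : dgg_of T1 -> dgg_of T2, forall x, embed u c2 (f x) = embed u c1 x.
  have [f fE] := ex _ _ _ _ t1 t2; have [g gE] := ex _ _ _ _ t2 t1.
  exists f, g; split; [exact: is_dgg_map_embed fE | exact: is_dgg_map_embed gE | |].
    by move=> x; apply: (embed_inj t1); rewrite gE fE.
  by move=> x; apply: (embed_inj t2); rewrite fE gE.
move=> s1 s2; have [d1 c1K d1K] := tl_bij s1.
(* Coefficients are moved between basis elements with the same subset. These have the same
   multidegree, so no monomial factor appears. *)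
exists (fun x : dgg_of T1 => [ffun b => (x : freemod K n (sc_basis T1)) (d1 (c2 b))]) => x.
apply/ffunP => F; have [b ->] := beta_surj s2 F.
rewrite (embedE s2) ffunE; rewrite -{3}(d1K (c2 b)) (embedE s1).
by rewrite d1K.
Qed.

Lemma taylor_taylor_like :
  @taylor_like K n r u (taylor_consts K u) id.
Proof. by split => //; exists id. Qed.

Lemma prod_natr_bool (I : finType) (p : pred I) :
  \prod_i ((p i)%:R : K) = [forall i, p i]%:R.
Proof.
have [/forallP h|] := boolP [forall i, p i].
  by rewrite big1 // => i _; rewrite h.
by rewrite negb_forall => /existsP[i /negPf hi]; rewrite (bigD1 i) //= hi mul0r.
Qed.

Local Notation gtk := (gen_taylor_consts (fun i => koszul_consts K (u i))).

Local Notation gt := {dffun forall i : 'I_r, sc_basis (koszul_consts K (u i))}.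
Local Notation "g @@ i" := ((g : gt) i : bool) (at level 10, i at next level).

Definition gt_support (g : sc_basis gtk) : {set 'I_r} := [set i | g @@ i].

Definition gt_of_set (F : {set 'I_r}) : sc_basis gtk :=
  (finfun (fun i => (i \in F) : sc_basis (koszul_consts K (u i))) : gt).

Lemma gen_taylor_taylor_like : @taylor_like K n r u gtk gt_support.
Proof.
split.
- exists gt_of_set.
    by move=> g; apply/ffunP => i; rewrite ffunE inE.
  by move=> F; apply/setP => i; rewrite inE ffunE.
- move=> g /=; rewrite /gt_hdeg -sum1_card [RHS]big_mkcond.
  by apply: eq_bigr => i _; rewrite inE /=; case: (g @@ i).
- move=> g; apply/mnmP => k; rewrite mlcm_setE /= /gt_mdeg.
  rewrite (big_morph (fun m : 'X_{1..n} => m k) (id1 := 0%N) (op1 := maxn)) ?mnm0E //.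
    rewrite [RHS]big_mkcond; apply: eq_bigr => i _; rewrite inE /=.
    by case: (g @@ i) => //; rewrite mnm0E.
  by move=> m p; rewrite mnmE.
- by apply/setP => i; rewrite !inE ffunE.
- move=> g a /=; rewrite /gt_diff [RHS]big_mkcond.
  apply: eq_bigr => i _ /=; rewrite inE.
  have [gi|gi] /= := boolP (g @@ i); last by rewrite mulr0 if_same.
  (* The tensor differential at position i replaces [f_i] by 1 and fixes the other positions, which
     amounts to removing i from the support. *)
  have -> : (gt_support a == gt_support g :\ i) =
      [forall l, (l != i) ==> (a @@ l == g @@ l)] && ~~ (a @@ i).
    apply/eqP/andP => [ag|[/forallP ag ai]].
      have agl l : a @@ l = (l != i) && g @@ l by move/setP/(_ l): ag; rewrite !inE.
      split; last by rewrite agl eqxx.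
      by apply/forallP => l; rewrite agl; case: eqP => //= _; rewrite eqxx.
    apply/setP => l; rewrite !inE; case: eqP (ag l) => [->|_ /eqP//].
    by rewrite (negPf ai).
  case: ifP => _; last by rewrite mulr0.
  congr ((-1) ^+ _ * _).
  rewrite /alpha1 -sum1_card big_mkcond [RHS]big_mkcond.
  by apply: eq_bigr => l _; rewrite !inE andbC /=; case: (l < i)%N; case: (g @@ l).
- move=> g h a /=; rewrite /gt_mul /= prod_natr_bool.
  (* The product of the Koszul constants is nonzero exactly when no position has [f_i] in both
     factors and a has the union as support. *)
  have -> : [forall i, ~~ ((g @@ i) && h @@ i) && ((a @@ i) == (g @@ i) || (h @@ i))] =
      [disjoint gt_support g & gt_support h] &&
      (gt_support a == gt_support g :|: gt_support h).
    rewrite -setI_eq0; apply/forallP/andP => [gha|[/eqP gh /eqP agh] i].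
      by split; apply/eqP/setP => i; rewrite !inE; have /andP[/negPf ? /eqP] := gha i.
    move/setP/(_ i): gh; move/setP/(_ i): agh; rewrite !inE => -> ->.
    by rewrite eqxx.
  case: ifP => _; last by rewrite mulr0.
  rewrite mulr1 alpha2E exchange_big [in RHS]big_mkcond; congr (_ ^+ _).
  apply: eq_bigr => i _; rewrite inE /=; case: (h @@ i); last by rewrite mul0n.
  rewrite mul1n big_mkcond [RHS]big_mkcond; apply: eq_bigr => j _; rewrite inE /=.
  by case: (i < j)%N; case: (g @@ j).
- move=> g k a /=; rewrite /gt_dpow; case: ifP => // _; case: pickP => // j _.
  (* The factor at position j is a Koszul divided power constant, which is zero. *)
  by rewrite (bigD1 j) //= eqxx mul0r.
Qed.
End TaylorLikeIso.

Theorem theorem4p1 (K : fieldType) (n r : nat) (u : 'I_r -> 'X_{1..n}) :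
  let T := taylor K u in
  let G := gen_taylor (fun i : 'I_r => koszul_consts K (u i)) in
  [/\ is_dgg_algebra T, is_dgg_algebra G & dgg_isomorphic T G].
Proof.
have tT := taylor_taylor_like K u; have tG := gen_taylor_taylor_like K u.
split; [exact: taylor_like_dgg tT | exact: taylor_like_dgg tG |].
exact: taylor_like_iso tT tG.
Qed.
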